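(* There exist universal positive constants $\hat A\le2$ and $\hat B\ge 2/\pi^2$ such that for every $H\in[1/2,1)$, every $S>0$, every $c\in(0,S^H]$ and every $u>0$, $$\mathbf P\left(\left|\mathrm{UTV}^c(W^H,S)-\mathbf E\,\mathrm{UTV}^c(W^H,S)\right|>u\right)\le \hat A\exp\left(-\hat B\,S^{-2H}u^2\right),$$ or, equivalently (writing $u=Sc^{1-\frac1H}v$), for every $v>0$, $$\mathbf P\left(\left|\mathrm{UTV}^c(W^H,S)-\mathbf E\,\mathrm{UTV}^c(W^H,S)\right|>Sc^{1-\frac1H}v\right)\le \hat A\exp\left(-\hat B\left(Sc^{-\frac1H}\right)^{2-2H}v^2\right).$$ The same estimates hold with $\mathrm{DTV}^c(W^H,S)$ in place of $\mathrm{UTV}^c(W^H,S)$.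
   Context: $W^H=(W^H_t)_{t\ge0}$ is a fractional Brownian motion with Hurst index $H\in(0,1)$, i.e. a centered Gaussian process with (a.s.) continuous trajectories and $\mathbf E(W^H_sW^H_t)=\frac12\{|s|^{2H}+|t|^{2H}-|t-s|^{2H}\}$ for $s,t\ge0$. For a path $f:[0,+\infty)\to\mathbb R$ that is right-continuous with left limits, $c\ge0$ and $0\le s<t$, the upward and downward truncated variations are $$\mathrm{UTV}^c(f,[s,t])=\sup_{n\ge1}\ \sup_{s\le s_1<t_1<s_2<t_2<\dots<s_n<t_n\le t}\ \sum_{i=1}^n\left(f(t_i)-f(s_i)-c\right)_+,$$ $$\mathrm{DTV}^c(f,[s,t])=\sup_{n\ge1}\ \sup_{s\le s_1<t_1<s_2<t_2<\dots<s_n<t_n\le t}\ \sum_{i=1}^n\left(f(s_i)-f(t_i)-c\right)_+,$$ with $(x)_+=\max(x,0)$; for $S>0$, $\mathrm{UTV}^c(f,S):=\mathrm{UTV}^c(f,[0,S])$ and $\mathrm{DTV}^c(f,S):=\mathrm{DTV}^c(f,[0,S])$. *)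

(* Defs.v *)
From HB Require Import structures.
From mathcomp Require Import all_boot all_order all_algebra.
From mathcomp Require Import all_classical all_reals all_analysis.
Import Order.TTheory GRing.Theory Num.Theory.
Import numFieldNormedType.Exports.

Set Implicit Arguments.
Unset Strict Implicit.
Unset Printing Implicit Defensive.

Local Open Scope classical_set_scope.
Local Open Scope ring_scope.

(* The points of index i < n of the sequences a and b satisfy
   s <= a 0 < b 0 < a 1 < b 1 < ... < a (n - 1) < b (n - 1) <= t. *)
Definition interlaced (R : realType) (s t : R) (n : nat) (a b : nat -> R) :
    Prop :=
  [/\ s <= a 0%N,
      forall i, (i < n)%N -> a i < b i,
      forall i, (i.+1 < n)%N -> b i < a i.+1 &
      b n.-1 <= t].

Definition UTV (R : realType) (c : R) (f : R -> R) (s t : R) : \bar R :=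
  ereal_sup [set x : \bar R | exists n (a b : nat -> R),
    [/\ (0 < n)%N, interlaced s t n a b &
        x = (\sum_(i < n) Num.max (f (b i) - f (a i) - c) 0)%:E]].

Definition DTV (R : realType) (c : R) (f : R -> R) (s t : R) : \bar R :=
  ereal_sup [set x : \bar R | exists n (a b : nat -> R),
    [/\ (0 < n)%N, interlaced s t n a b &
        x = (\sum_(i < n) Num.max (f (a i) - f (b i) - c) 0)%:E]].

(* Gaussian laws include the Dirac masses. These are a separate case because
   [normal_prob m 0] is by convention the uniform law on [0, 1]. *)
Definition gaussian_rv d (T : measurableType d) (R : realType)
    (P : probability T R) (X : T -> R) : Prop :=
  exists m s : R, 0 <= s /\
    forall B : set R, measurable B ->
      P (X @^-1` B) = if s == 0 then \d_m B else normal_prob m s B.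

Definition gaussian_process d (T : measurableType d) (R : realType)
    (P : probability T R) (W : R -> {RV P >-> R}) : Prop :=
  forall (n : nat) (t a : 'I_n -> R), (forall i, 0 <= t i) ->
    gaussian_rv P (fun w => \sum_(i < n) a i * W (t i) w).

(* The time set is [0, +oo[: [W t] is unconstrained for t < 0. *)
Definition fractional_brownian_motion d (T : measurableType d) (R : realType)
    (P : probability T R) (H : R) (W : R -> {RV P >-> R}) : Prop :=
  [/\ 0 < H < 1,
      gaussian_process W,
      forall t, 0 <= t -> ('E_P[W t] = 0)%E,
      forall s t, 0 <= s -> 0 <= t ->
        'E_P[(fun w => W s w * W t w)%R]%E =
        (2^-1 * (`|s| `^ (2 * H) + `|t| `^ (2 * H) - `|t - s| `^ (2 * H)))%:E
    & {ae P, forall w, {within `[0, +oo[, continuous (fun t => W t w)}}].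

(* P (|X - E X| > r) for an extended real random variable X. Trajectories are
   only almost surely continuous and P need not be complete, so that X (a
   truncated variation) may be measurable only for the completion of P. The
   outer measure [mu_ext P] equals P on measurable events and the completed
   probability on events of the completion; likewise the integral of a
   nonnegative X is its integral for the completed probability. If E X is
   infinite, |X - E X| is +oo everywhere. *)
Definition deviation_prob d (T : measurableType d) (R : realType)
    (P : probability T R) (X : T -> \bar R) (r : R) : \bar R :=
  mu_ext P [set w | (r%:E < `|X w - \int[P]_w' X w'|)%E].

(* Main.v *)
(* For a continuous path, UTV^c is the supremum of the countably many affine
   functionals f |-> sum_(i in e) (f (b_i) - f (a_i) - c) with rational times, and
   DTV^c f = UTV^c (- f). For H >= 1/2 the increments of fractional Brownian
   motion over disjoint intervals are positively correlated, so that each of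
   these functionals has variance at most that of the increment over [0, S],
   i.e. S^(2H). Deviations of such a supremum F obey a Gaussian bound by the
   argument of Maurey and Pisier: with an independent copy Y of X, rotate
   (X, Y) along a quarter circle; by invariance under rotation and Jensen's
   inequality, E exp (l (F X - F Y)) <= exp (l^2 pi^2 S^(2H) / 8), and l is
   optimized in Markov's inequality. *)

Require Import Defs.
From HB Require Import structures.
From mathcomp Require Import all_boot all_order all_algebra.
From mathcomp Require Import all_classical all_reals all_analysis.
From mathcomp Require Import measurable_realfun ring lra.
Import Order.TTheory GRing.Theory Num.Theory.
Import numFieldNormedType.Exports.
Local Open Scope classical_set_scope.
Local Open Scope ring_scope.

Set Implicit Arguments.
Unset Strict Implicit.
Unset Printing Implicit Defensive.

(** * Gaussian laws *)

(** A maximum of affine functionals is not differentiable, so the rotation is cut into finitely many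
    equal steps. In one step the increment is at most that of the maximizing functional; given the
    first copy this index is fixed, and the second copy contributes the exponential moment of a
    single functional. Hence only individual variances matter. The second order error of a step, 1 -
    cos, disappears as the steps are refined. The quarter circle has length pi / 2, whence the
    variance (pi / 2)^2 S^(2H) and the 8 in the exponent.

    A Gaussian process is given by the laws of its linear combinations, whereas rotation invariance
    concerns joint laws: this is the role of the Cramer-Wold theorem. The parameters of the laws are
    recovered from the prescribed means and covariances through exponential moments.

    The bounds for finite maxima are uniform in their number, but centring the supremum requires a
    finite mean. It follows from almost sure finiteness of the truncated variation, due to c > 0 and
    continuity. The truncated variation equals the countable supremum only off a null set, so
    measurability is kept on the side of the supremum. *)

Section density.
Context d (T : measurableType d) (R : realType).
Variables (m mu : {measure set T -> \bar R}) (g : T -> R).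
Hypotheses (mg : measurable_fun setT g) (g0 : forall x, 0 <= g x).
Hypothesis mE : forall A, measurable A -> m A = (\int[mu]_(x in A) (g x)%:E)%E.

Import HBNNSimple.

Let density_nnsfun (f : {nnsfun T >-> R}) :
  (\int[m]_x (f x)%:E = \int[mu]_x ((f x)%:E * (g x)%:E))%E.
Proof.
under eq_integral do rewrite fimfunE -fsumEFin//.
rewrite ge0_integral_fsum//; last 2 first.
  - by move=> r; exact/measurable_EFinP/measurableT_comp.
  - by move=> n x _; rewrite EFinM nnfun_muleindic_ge0.
under [RHS]eq_integral.
  move=> x _; rewrite fimfunE -fsumEFin// ge0_mule_fsuml; last first.
    by move=> r; rewrite EFinM nnfun_muleindic_ge0.
  over.
rewrite [RHS]ge0_integral_fsum//; last 2 first.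
  - move=> r; apply: emeasurable_funM; last exact/measurable_EFinP.
    by apply/measurable_EFinP; do 2 apply/measurableT_comp => //.
  - by move=> n x _; apply: mule_ge0; rewrite ?lee_fin // -lee_fin EFinM nnfun_muleindic_ge0.
apply: eq_fsbigr => r _.
have [r0|r0] := leP 0 r; last first.
  rewrite (_ : f @^-1` [set r] = set0); last first.
    by apply/seteqP; split => // x /= fxr; have : 0 <= f x by []; rewrite fxr leNgt r0.
  under eq_integral do rewrite indic0/= mulr0.
  under [RHS]eq_integral do rewrite indic0/= mulr0 mul0e.
  by rewrite !integral0.
under eq_integral do rewrite EFinM.
under [RHS]eq_integral do rewrite EFinM -muleA.
rewrite ge0_integralZl//; last first.
  exact/measurable_EFinP/measurable_indic.
rewrite [RHS]ge0_integralZl//; last 2 first.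
  - apply: emeasurable_funM; last exact/measurable_EFinP.
    exact/measurable_EFinP/measurable_indic.
  - by move=> x _; rewrite mule_ge0// lee_fin.
rewrite integral_indic//= setIT mE//; congr (_ * _)%E.
rewrite [LHS]integral_mkcond; apply: eq_integral => x _.
by rewrite patchE indicE; case: ifPn; rewrite ?mul1e ?mul0e.
Qed.

Lemma ge0_integral_density (f : T -> \bar R) :
  measurable_fun setT f -> (forall x, (0 <= f x)%E) ->
  (\int[m]_x f x = \int[mu]_x (f x * (g x)%:E))%E.
Proof.
move=> mf f0.
pose f_ := nnsfun_approx measurableT mf.
transitivity (lim (\int[m]_x (f_ n x)%:E @[n --> \oo])%E).
  rewrite -monotone_convergence//=.
  - apply: eq_integral => ? /[!inE] xD; apply/esym/cvg_lim => //=.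
    exact: cvg_nnsfun_approx.
  - by move=> n; exact/measurable_EFinP/measurable_funTS.
  - by move=> n ? _; rewrite lee_fin.
  - by move=> ? _ ? ? mn; rewrite lee_fin; exact/lefP/nd_nnsfun_approx.
under eq_fun do rewrite density_nnsfun.
rewrite -monotone_convergence//=.
- apply: eq_integral => x _; apply/cvg_lim => //=.
  (* Where [g x = 0] the limit [f x] may be infinite, and the product rule for limits fails
     there. *)
  have [->|gx0] := eqVneq (g x) 0.
    by rewrite mule0; under eq_fun do rewrite mule0; exact: cvg_cst.
  apply: cvgeM; [|exact: cvg_nnsfun_approx|exact: cvg_cst].
  by rewrite /mule_def; case: (f x).
- move=> n; apply: emeasurable_funM; last exact/measurable_EFinP.
  exact/measurable_EFinP/measurable_funTS.
- by move=> n x _; rewrite mule_ge0// lee_fin.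
- move=> x _ a b ab; rewrite lee_wpmul2r ?lee_fin//.
  exact/lefP/nd_nnsfun_approx.
Qed.

End density.

(** * Exponential moments of normal laws *)

Section normal_mgf.
Context (R : realType).
Implicit Types m s v l : R.
Local Notation mu := (@lebesgue_measure R).

Lemma ge0_integral_normal_prob m s (f : R -> \bar R) :
  measurable_fun setT f -> (forall x, (0 <= f x)%E) ->
  (\int[normal_prob m s]_x f x = \int[mu]_x (f x * (normal_pdf m s x)%:E))%E.
Proof.
move=> mf f0; apply: ge0_integral_density => //.
- exact: measurable_normal_pdf.
- by move=> x; exact: normal_pdf_ge0.
Qed.

(** Completing the square: an exponential tilt by [l] moves the mean by [l * s ^+ 2], and the
    remaining factor is the exponential moment. *)
Lemma normal_pdf_tilt m s l x : s != 0 ->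
  expR (l * x) * normal_pdf m s x =
  expR (l * m + l ^+ 2 * s ^+ 2 / 2) * normal_pdf (m + l * s ^+ 2) s x.
Proof.
move=> s0; rewrite !normal_pdfE// mulrCA [RHS]mulrCA; congr (_ * _).
rewrite /normal_fun -!expRD; congr expR.
by field.
Qed.

Lemma normal_prob_mgf m s l : s != 0 ->
  (\int[normal_prob m s]_x (expR (l * x))%:E =
   (expR (l * m + l ^+ 2 * s ^+ 2 / 2))%:E)%E.
Proof.
move=> s0; rewrite ge0_integral_normal_prob//; last first.
  by apply/measurable_EFinP; apply: measurableT_comp => //; exact: measurable_funM.
under eq_integral do rewrite -EFinM normal_pdf_tilt// EFinM.
rewrite ge0_integralZl//.
- by rewrite integral_normal_pdf mule1.
- by apply/measurable_EFinP; exact: measurable_normal_pdf.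
- by move=> x _; rewrite lee_fin normal_pdf_ge0.
Qed.

Section law.
Context d (T : measurableType d) (P : probability T R).

Lemma ge0_integral_law (m : {measure set (measurableTypeR R) -> \bar R}) (X : T -> R)
    (f : R -> \bar R) : measurable_fun setT X ->
  (forall B, measurable B -> P (X @^-1` B) = m B) ->
  measurable_fun setT f -> (forall x, (0 <= f x)%E) ->
  (\int[P]_w f (X w) = \int[m]_x f x)%E.
Proof.
move=> mX XE mf f0.
have <- := @ge0_integral_pushforward _ _ T (measurableTypeR R) R X mX P setT f measurableT mf
  (fun x _ => f0 x).
by apply: eq_measure_integral => A mA _; rewrite -XE.
Qed.

Lemma gaussian_mgf (X : T -> R) : measurable_fun setT X -> gaussian_rv P X ->
  exists m s : R, [/\ 0 <= s, (forall B : set R, measurable B ->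
      P (X @^-1` B) = if s == 0 then \d_m B else normal_prob m s B) &
   forall l, (\int[P]_w (expR (l * X w))%:E =
    (expR (l * m + l ^+ 2 * s ^+ 2 / 2))%:E)%E].
Proof.
move=> mX [m [s [s0 XE]]]; exists m, s; split => // l.
have me : measurable_fun setT (fun x : R => (expR (l * x))%:E).
  by apply/measurable_EFinP; apply: measurableT_comp => //; exact: measurable_funM.
have e0 x : (0 <= (expR (l * x))%:E)%E by rewrite lee_fin expR_ge0.
have [se|sn0] := eqVneq s 0.
  rewrite (@ge0_integral_law (@dirac _ (measurableTypeR R) m R) X (fun x => (expR (l * x))%:E))//; last first.
    by move=> B mB; rewrite XE// se eqxx.
  rewrite integral_dirac//= diracT mul1e se.
  by rewrite expr0n/= mulr0 mul0r addr0.
rewrite (@ge0_integral_law (normal_prob m s) X (fun x => (expR (l * x))%:E))//.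
  exact: normal_prob_mgf.
by move=> B mB; rewrite XE// (negbTE sn0).
Qed.

End law.
End normal_mgf.

(** * Elementary bounds for the exponential and the hyperbolic cosine *)

Section expR_bounds.
Context (R : realType).
Implicit Types x y z l : R.

Lemma expR_tangent x y : expR y * (1 + x - y) <= expR x.
Proof.
rewrite -[X in _ <= expR X](subrKC y) expRD ler_wpM2l ?expR_ge0//.
by rewrite -addrA expR_ge1Dx.
Qed.

(** Convexity between [0] and [x]. The right side is linear in [l], so errors with a small [l] are
    controlled by an exponential moment at a fixed parameter. *)
Lemma expR_convex0 l x : 0 <= l <= 1 -> expR (l * x) <= 1 + l * expR x.
Proof.
move=> /andP[l0 l1].
have h0 := expR_tangent 0 (l * x); rewrite expR0 in h0.
have h1 := expR_tangent x (l * x).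
have H0 := ler_wpM2l (_ : 0 <= 1 - l) h0.
have H1 := ler_wpM2l l0 h1.
have {}H0 := H0 ltac:(by rewrite subr_ge0).
nra.
Qed.

Lemma expR_ge1Dx2 x : 0 <= x -> 1 + x + x ^+ 2 / 2 <= expR x.
Proof.
move=> x0.
have -> : 1 + x + x ^+ 2 / 2 = series (exp_coeff x) 3.
  rewrite /series /= !big_nat_recr//= big_nil /exp_coeff /=.
  by rewrite expr0 expr1 !divr1 add0r.
apply: nondecreasing_cvgn_le; last exact: is_cvg_series_exp_coeff.
apply: nondecreasing_series => n _ _.
by rewrite /exp_coeff /= divr_ge0// exprn_ge0.
Qed.

Lemma expR2_ge x : 0 <= x -> x ^+ 2 <= 2 * expR x.
Proof. by move=> x0; have := expR_ge1Dx2 x0; nra. Qed.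

(** With [z = x / 2], the hyperbolic cosine minus 1 is half the square of [expR z - expR (- z)],
    which is at least [2 * z] for [z >= 0]. *)
Lemma cosh_ge x : 1 + x ^+ 2 / 2 <= (expR x + expR (- x)) / 2.
Proof.
wlog x0 : x / 0 <= x.
  move=> h; have [/h//|/ltW x0] := leP 0 x.
  by have := h (- x); rewrite oppr_ge0 opprK sqrrN addrC => /(_ x0); rewrite addrC (addrC (expR _)).
pose z := x / 2; have z0 : 0 <= z by rewrite /z; lra.
have hz := expR_ge1Dx2 z0.
have e0 : 0 < expR (- z) by exact: expR_gt0.
have ezE : expR z * expR (- z) = 1 by rewrite -expRD subrr expR0.
have -> : expR x = expR z ^+ 2 by rewrite -expRM_natl; congr expR; rewrite /z; field.
have -> : expR (- x) = expR (- z) ^+ 2.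
  by rewrite -expRM_natl; congr expR; rewrite /z; field.
have -> : x = 2 * z by rewrite /z; field.
have h2 : expR (- z) <= 1 - z + z ^+ 2 / 2.
  have h3 : expR (- z) * (1 + z + z ^+ 2 / 2) <= 1.
    by have := ler_wpM2l (ltW e0) hz; rewrite (mulrC _ (expR z)) ezE.
  rewrite -(@ler_pM2r _ (1 + z + z ^+ 2 / 2)); last by nra.
  apply: (le_trans h3); nra.
have h4 : 2 * z <= expR z - expR (- z) by lra.
have h5 : (2 * z) ^+ 2 <= (expR z - expR (- z)) ^+ 2.
  by rewrite lerXn2r// nnegrE; lra.
rewrite sqrrB in h5; rewrite ezE in h5; lra.
Qed.

(** The same identity at [z = x / 2], with [expR z - expR (- z) <= 2 * z * expR z] from the tangent
    at [z]. *)
Lemma cosh_le x : (expR x + expR (- x)) / 2 <= 1 + x ^+ 2 / 2 * expR `|x|.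
Proof.
wlog x0 : x / 0 <= x.
  move=> h; have [/h//|/ltW x0] := leP 0 x.
  by have := h (- x); rewrite oppr_ge0 opprK sqrrN addrC normrN (addrC (expR _)); exact.
rewrite ger0_norm//; pose z := x / 2; have z0 : 0 <= z by rewrite /z; lra.
have ezE : expR z * expR (- z) = 1 by rewrite -expRD subrr expR0.
have -> : expR x = expR z ^+ 2 by rewrite -expRM_natl; congr expR; rewrite /z; field.
have -> : expR (- x) = expR (- z) ^+ 2.
  by rewrite -expRM_natl; congr expR; rewrite /z; field.
have -> : x = 2 * z by rewrite /z; field.
have e0 : 0 < expR z by exact: expR_gt0.
have h1 : expR (- z) <= expR z by rewrite ler_expR; lra.
have h2 : expR z - expR (- z) <= 2 * z * expR z.
  have := expR_tangent (- z) z; lra.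
have h5 : (expR z - expR (- z)) ^+ 2 <= (2 * z * expR z) ^+ 2.
  by rewrite lerXn2r// nnegrE; [lra|nra].
rewrite sqrrB ezE exprMn in h5; lra.
Qed.

End expR_bounds.

Section ge0_real_integral.
Context d (T : measurableType d) (R : realType) (mu : {measure set T -> \bar R}).
Implicit Types f g : T -> R.

Lemma ge0_integral_comb f g a b u v :
  measurable_fun setT f -> measurable_fun setT g ->
  (forall x, 0 <= f x) -> (forall x, 0 <= g x) -> 0 <= a -> 0 <= b ->
  (\int[mu]_x (f x)%:E = u%:E)%E -> (\int[mu]_x (g x)%:E = v%:E)%E ->
  (\int[mu]_x (a * f x + b * g x)%:E = (a * u + b * v)%:E)%E.
Proof.
move=> mf mg f0 g0 a0 b0 fu gv.
under eq_integral do rewrite EFinD !EFinM.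
rewrite ge0_integralD//=.
- rewrite !ge0_integralZl//=; try exact/measurable_EFinP.
  + by rewrite fu gv -!EFinM.
  + by move=> x _; rewrite lee_fin.
  + by move=> x _; rewrite lee_fin.
- by move=> x _; rewrite mule_ge0 ?lee_fin.
- by apply/measurable_EFinP; exact: measurable_funM.
- by move=> x _; rewrite mule_ge0 ?lee_fin.
- by apply/measurable_EFinP; exact: measurable_funM.
Qed.

Lemma ge0_le_integral_fin f g u v :
  measurable_fun setT f -> measurable_fun setT g ->
  (forall x, 0 <= f x) -> (forall x, f x <= g x) ->
  (\int[mu]_x (f x)%:E = u%:E)%E -> (\int[mu]_x (g x)%:E = v%:E)%E -> u <= v.
Proof.
move=> mf mg f0 fg fu gv; rewrite -lee_fin -fu -gv.
apply: ge0_le_integral => //.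
- by move=> x _; rewrite lee_fin.
- exact/measurable_EFinP.
- exact/measurable_EFinP.
- by move=> x _; rewrite lee_fin.
Qed.

Lemma ge0_integrable_fin f u : measurable_fun setT f -> (forall x, 0 <= f x) ->
  (\int[mu]_x (f x)%:E = u%:E)%E -> mu.-integrable setT (EFin \o f).
Proof.
move=> mf f0 fu; apply/integrableP; split; first exact/measurable_EFinP.
rewrite (eq_integral (fun x => (f x)%:E)) ?fu ?ltry// => x _.
by rewrite abse_EFin ger0_norm.
Qed.

End ge0_real_integral.

(** * Identification of a Gaussian law by its first two moments *)

Section centered_gaussian.
Context (R : realType).

(** Parametrized by the variance, so that convolution adds the parameters and [v = 0] is the Dirac
    mass at 0. *)
Definition gauss (v : R) : probability (measurableTypeR R) R :=
  if v == 0
  then (@dirac _ (measurableTypeR R) 0 R : probability (measurableTypeR R) R)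
  else (normal_prob 0 (Num.sqrt v) : probability (measurableTypeR R) R).

Definition centered_gaussian d (T : measurableType d) (P : probability T R)
    (v : R) (X : T -> R) : Prop :=
  0 <= v /\ forall B : set R, measurable B -> P (X @^-1` B) = gauss v B.

Context d (T : measurableType d) (P : probability T R).
Implicit Types X : T -> R.

Lemma quadratic_ge0 (m s : R) :
  (forall l, 0 <= l * m + l ^+ 2 * s ^+ 2 / 2) -> m = 0.
Proof.
move=> h; apply/eqP; apply: contraT => m0.
have k0 : 0 < s ^+ 2 + 1 by rewrite ltr_wpDl// sqr_ge0.
have m2 : 0 < m ^+ 2 by rewrite exprn_even_gt0.
(* Nearly the minimizer [- m / s ^+ 2] of the quadratic; the added 1 covers [s = 0]. *)
have := h (- (m / (s ^+ 2 + 1))).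
have -> : - (m / (s ^+ 2 + 1)) * m + (- (m / (s ^+ 2 + 1))) ^+ 2 * s ^+ 2 / 2 =
   - (m ^+ 2 * (s ^+ 2 + 2) / (2 * (s ^+ 2 + 1) ^+ 2)).
  by field; exact: lt0r_neq0.
rewrite oppr_ge0 leNgt => /negP; case.
rewrite divr_gt0//; last by rewrite mulr_gt0// exprn_gt0.
by rewrite mulr_gt0// ltr_wpDl ?sqr_ge0.
Qed.

Lemma le_small (a b e C : R) : 0 <= C -> 0 < e ->
  (forall l, 0 < l -> l <= e -> a <= b + l * C) -> a <= b.
Proof.
move=> C0 e0 h; rewrite leNgt; apply/negP => ab.
have C1 : 0 < C + 1 by rewrite ltr_wpDl.
pose l := Num.min e ((a - b) / (C + 1) / 2).
have ab0 : 0 < (a - b) / (C + 1) / 2 by rewrite !divr_gt0// subr_gt0.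
have l0 : 0 < l by rewrite lt_min e0.
have := h l l0; rewrite ge_min lexx => /(_ isT).
have : l <= (a - b) / (C + 1) / 2 by rewrite ge_min lexx orbT.
rewrite -mulrA -invfM ler_pdivlMr ?mulr_gt0//; nra.
Qed.

(** Integrating [1 + l * X <= expR (l * X)] with [E X = 0] shows that the exponential moment is at
    least 1 for every [l] of either sign; a quadratic without constant term is nonnegative
    everywhere only if its linear term vanishes. *)
Lemma gaussian_mean0 X (m s : R) : measurable_fun setT X ->
  (forall l, (\int[P]_w (expR (l * X w))%:E =
    (expR (l * m + l ^+ 2 * s ^+ 2 / 2))%:E)%E) ->
  (\int[P]_w (X w)%:E = 0)%E -> m = 0.
Proof.
move=> mX mgf EX; apply: (@quadratic_ge0 m s) => l.
have mE k : measurable_fun setT (fun w => expR (k * X w)).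
  by apply: measurableT_comp => //; exact: measurable_funM.
have iE k : P.-integrable setT (fun w => (expR (k * X w))%:E).
  exact: (ge0_integrable_fin (mE k) (fun w => expR_ge0 _) (mgf k)).
have iX : P.-integrable setT (EFin \o X).
  apply: (@le_integrable _ _ _ P _ measurableT _
      (fun w => (expR (1 * X w))%:E + (expR ((-1) * X w))%:E)%E).
  - exact/measurable_EFinP.
  - move=> w _ /=; rewrite lee_fin [leRHS]ger0_norm ?addr_ge0 ?expR_ge0//.
    rewrite !mul1r mulN1r.
    have h1 := expR_ge1Dx (X w); have h2 := expR_ge1Dx (- X w).
    have h3 := expR_ge0 (X w); have h4 := expR_ge0 (- X w).
    by rewrite ler_norml; apply/andP; split; lra.
  - exact: integrableD.
have i1 : P.-integrable setT (fun w => (1 : R)%:E).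
  exact: finite_measure_integrable_cst.
have ilX : P.-integrable setT (fun w => (l%:E * (X w)%:E)%E).
  exact: integrableZl.
have : (\int[P]_w (1%:E + l%:E * (X w)%:E) <= \int[P]_w (expR (l * X w))%:E)%E.
  apply: le_integral => //; first exact: integrableD.
  by move=> w _; rewrite -EFinM -EFinD lee_fin expR_ge1Dx.
rewrite mgf integralD//= integralZl//= EX mule0 adde0 integral_cst//=.
by rewrite probability_setT mule1 lee_fin -[X in X <= _]expR0 ler_expR.
Qed.

(* Compare the second order expansions of E exp (l X) at l = 0. *)
Lemma gaussian_var X (s v : R) : measurable_fun setT X -> 0 <= v ->
  (forall l, (\int[P]_w (expR (l * X w))%:E =
    (expR (l ^+ 2 * s ^+ 2 / 2))%:E)%E) ->
  (\int[P]_w (X w ^+ 2)%:E = v%:E)%E -> s ^+ 2 = v.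
Proof.
move=> mX v0 mgf EX.
have mE l : measurable_fun setT (fun w => expR (l * X w)).
  by apply: measurableT_comp => //; exact: measurable_funM.
have mC : measurable_fun setT (fun w => expR (X w)).
  exact: measurableT_comp.
have cosh_int l : (\int[P]_w (2^-1 * expR (l * X w) + 2^-1 * expR (- l * X w))%:E
    = (expR (l ^+ 2 * s ^+ 2 / 2))%:E)%E.
  rewrite (ge0_integral_comb _ _ _ _ _ _ (mgf l) (mgf (- l)))//.
    by rewrite sqrrN; congr EFin; field.
have low l : 1 + l ^+ 2 * v / 2 <= expR (l ^+ 2 * s ^+ 2 / 2).
  have h := @ge0_integral_comb _ _ _ P (cst 1) (fun w => X w ^+ 2) 1 (l ^+ 2 / 2) 1 v.
  have -> : 1 + l ^+ 2 * v / 2 = 1 * 1 + l ^+ 2 / 2 * v by ring.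
  apply: (ge0_le_integral_fin _ _ _ _ (h _ _ _ _ _ _ _ _) (cosh_int l)) => //=.
  - by apply: measurable_funD => //; apply: measurable_funM => //; exact: measurable_funX.
  - by apply: measurable_funD => //; apply: measurable_funM => //.
  - move=> w; apply: addr_ge0; first by rewrite mul1r.
    by apply: mulr_ge0; [rewrite divr_ge0 ?sqr_ge0|exact: sqr_ge0].
  - by move=> w; have := cosh_ge (l * X w); rewrite mulNr; lra.
  - exact: measurable_funX.
  - by move=> w; rewrite sqr_ge0.
  - by rewrite divr_ge0 ?sqr_ge0.
  - by rewrite integral_cst//= probability_setT mule1.
(* The remainder of order [l ^+ 3] is dominated by a multiple of the hyperbolic cosine of [2 * X],
   whose mean is the exponential moment at parameter 2. *)
have up l : 0 <= l <= 1 -> expR (l ^+ 2 * s ^+ 2 / 2) <=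
    1 + l ^+ 2 / 2 * v + 2 * l ^+ 3 * expR (2 * s ^+ 2).
  move=> /andP[l0 l1].
  have h1 := @ge0_integral_comb _ _ _ P (cst 1) (fun w => X w ^+ 2) 1 (l ^+ 2 / 2) 1 v.
  have h := @ge0_integral_comb _ _ _ P
    (fun w => 1 * cst 1 w + l ^+ 2 / 2 * X w ^+ 2)
    (fun w => 2^-1 * expR (2 * X w) + 2^-1 * expR (- 2 * X w)) 1 (2 * l ^+ 3)
    (1 * 1 + l ^+ 2 / 2 * v) (expR (2 ^+ 2 * s ^+ 2 / 2)).
  have -> : 1 + l ^+ 2 / 2 * v + 2 * l ^+ 3 * expR (2 * s ^+ 2) =
    1 * (1 * 1 + l ^+ 2 / 2 * v) + 2 * l ^+ 3 * (expR (2 ^+ 2 * s ^+ 2 / 2)).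
    have -> : 2 ^+ 2 * s ^+ 2 / 2 = 2 * s ^+ 2 by field.
    ring.
  apply: (ge0_le_integral_fin _ _ _ _ (cosh_int l) (h _ _ _ _ _ _ _ _)) => //=.
  - by apply: measurable_funD => //; apply: measurable_funM.
  - apply: measurable_funD => //; apply: measurable_funM => //.
      by apply: measurable_funD => //; apply: measurable_funM => //; exact: measurable_funX.
    by apply: measurable_funD => //; apply: measurable_funM.
  - move=> w; rewrite !mul1r !mulNr.
    have k1 := cosh_le (l * X w).
    have k2 : expR `|l * X w| <= 1 + l * expR `|X w|.
      by rewrite normrM ger0_norm// expR_convex0// l0.
    have k3 : X w ^+ 2 * expR `|X w| <= 2 * (expR (2 * X w) + expR (- (2 * X w))).
      have e2 : expR `|X w| ^+ 2 <= expR (2 * X w) + expR (- (2 * X w)).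
        rewrite -expRM_natl; have [x0|x0] := leP 0 (X w).
          by rewrite (ger0_norm x0) lerDl expR_ge0.
        by rewrite (ltr0_norm x0) -[X in X <= _]add0r mulrN lerD2r expR_ge0.
      have := expR2_ge (normr_ge0 (X w)); rewrite real_normK ?num_real//.
      have := expR_ge0 `|X w|; nra.
    have k4 : l ^+ 2 * X w ^+ 2 / 2 * expR `|l * X w| <=
        l ^+ 2 * X w ^+ 2 / 2 * (1 + l * expR `|X w|).
      by rewrite ler_wpM2l// divr_ge0// mulr_ge0// sqr_ge0.
    have k5 : l ^+ 3 / 2 * (X w ^+ 2 * expR `|X w|) <=
       l ^+ 3 / 2 * (2 * (expR (2 * X w) + expR (- (2 * X w)))).
      by rewrite ler_wpM2l// divr_ge0// exprn_ge0.
    rewrite exprMn in k1; lra.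
  - by apply: measurable_funD => //; apply: measurable_funM => //; exact: measurable_funX.
  - by apply: measurable_funD => //; apply: measurable_funM.
  - move=> w; apply: addr_ge0; first by rewrite mul1r.
    by apply: mulr_ge0; [rewrite divr_ge0 ?sqr_ge0|exact: sqr_ge0].
  - by rewrite mulr_ge0// exprn_ge0.
  - apply: h1 => //=.
    + exact: measurable_funX.
    + by move=> w; rewrite sqr_ge0.
    + by rewrite divr_ge0 ?sqr_ge0.
    + by rewrite integral_cst//= probability_setT mule1.
apply/eqP; rewrite eq_le; apply/andP; split.
  apply: (@le_small _ _ 1 (4 * expR (2 * s ^+ 2))) => // l l0 l1.
  have := up l; rewrite l1 ltW// => /(_ isT).
  have := expR_ge1Dx (l ^+ 2 * s ^+ 2 / 2).
  set E := expR (2 * _); set e := expR _ => h1 h2.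
  rewrite -(@ler_pM2l _ (l ^+ 2 / 2)) ?divr_gt0 ?exprn_gt0//.
  have := le_trans h1 h2; lra.
have s20 := sqr_ge0 s.
have k0 : 0 < 1 + s ^+ 2 by rewrite ltr_wpDr.
(* Up to this threshold [l ^+ 2 * s ^+ 2 <= 1], so the tangent inequality bounds the exponential by
   the inverse of [1 - l ^+ 2 * s ^+ 2 / 2]; the constant comes from the cross term of the product
   [h3]. *)
apply: (@le_small _ _ (1 + s ^+ 2)^-1 (v * s ^+ 2 / 2)) => [||l l0 l1].
- by rewrite divr_ge0// mulr_ge0.
- by rewrite invr_gt0.
have := low l; have := expR_tangent 0 (l ^+ 2 * s ^+ 2 / 2); rewrite expR0.
set e := expR _ => h1 h2.
have l1' : l * (1 + s ^+ 2) <= 1 by rewrite -ler_pdivlMr// mul1r.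
have ls : l * s ^+ 2 <= 1 by nra.
have ll : l <= 1 by nra.
have lls : l ^+ 2 * s ^+ 2 <= 1 by nra.
have h3 : (1 + l ^+ 2 * v / 2) * (1 + 0 - l ^+ 2 * s ^+ 2 / 2) <= 1.
  by apply: le_trans h1; rewrite ler_wpM2r//; lra.
have h4 : l ^+ 2 * (v - s ^+ 2) <= l ^+ 2 * (l ^+ 2 * (v * s ^+ 2 / 2)) by lra.
rewrite ler_pM2l ?exprn_gt0// in h4.
have : l ^+ 2 * (v * s ^+ 2 / 2) <= l * (v * s ^+ 2 / 2).
  apply: ler_wpM2r; first by rewrite divr_ge0// mulr_ge0.
  by rewrite expr2 ler_piMl// ltW.
lra.
Qed.

Lemma gaussian_centered X (v : R) : measurable_fun setT X -> gaussian_rv P X ->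
  (\int[P]_w (X w)%:E = 0)%E -> (\int[P]_w (X w ^+ 2)%:E = v%:E)%E ->
  centered_gaussian P v X.
Proof.
move=> mX gX EX0 EX2.
have v0 : 0 <= v by rewrite -lee_fin -EX2; apply: integral_ge0 => w _; rewrite lee_fin sqr_ge0.
have [m [s [s0 XE mgf]]] := gaussian_mgf mX gX.
have m0 := gaussian_mean0 mX mgf EX0.
have sv : s ^+ 2 = v.
  apply: (gaussian_var mX v0 _ EX2) => l.
  by rewrite mgf m0 mulr0 add0r.
split=> // B mB; rewrite XE// /gauss -sv sqrf_eq0 sqrtr_sqr (ger0_norm s0) m0.
by case: ifP.
Qed.

Lemma centered_gaussian_mgf X v : measurable_fun setT X ->
  centered_gaussian P v X ->
  forall l, (\int[P]_w (expR (l * X w))%:E = (expR (l ^+ 2 * v / 2))%:E)%E.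
Proof.
move=> mX [v0 XE] l.
have me : measurable_fun setT (fun x : R => (expR (l * x))%:E).
  by apply/measurable_EFinP; apply: measurableT_comp => //; exact: measurable_funM.
have e0 x : (0 <= (expR (l * x))%:E)%E by rewrite lee_fin expR_ge0.
rewrite (@ge0_integral_law _ _ _ _ (gauss v) X (fun x => (expR (l * x))%:E))//.
rewrite /gauss; have [->|vn0] := eqVneq v 0.
  by rewrite integral_dirac//= diracT mul1e !mulr0 mul0r.
by rewrite normal_prob_mgf ?sqrtr_eq0 -?ltNge ?lt0r ?vn0// sqr_sqrtr// mulr0 add0r.
Qed.

End centered_gaussian.

(** * Sums of independent centered Gaussian variables *)

Section convolution.
Context (R : realType).
Local Notation mu := (@lebesgue_measure R).

Lemma lebesgue_measure_shift (r : R) (B : set R) : measurable B ->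
  mu [set t | B (r + t)] = mu B.
Proof.
move=> mB.
have mr : measurable_fun setT (fun t : measurableTypeR R => (r + t : measurableTypeR R)).
  exact: measurable_funD.
have -> : mu [set t | B (r + t)] = pushforward mu (fun t : measurableTypeR R => (r + t : measurableTypeR R)) B by [].
apply/esym; apply: (@lebesgue_measure_unique _ (pushforward mu (fun t : measurableTypeR R => (r + t : measurableTypeR R)))) => // X [[a b] _ <-].
transitivity (mu `](a - r), (b - r)]%classic).
  rewrite !lebesgue_measure_itv /= !lte_fin ltrD2r; case: ifP => // _.
  by rewrite -!EFinB; congr EFin; ring.
apply: (congr1 mu); apply/seteqP; split => t /=;
  by rewrite !in_itv/= ltrBlDl lerBrDl.
Qed.

Lemma ge0_integral_shift (r : R) (f : R -> \bar R) :
  measurable_fun setT f -> (forall x, (0 <= f x)%E) ->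
  (\int[mu]_t f (r + t)%R = \int[mu]_t f t)%E.
Proof.
move=> mf f0.
have mr : measurable_fun setT (fun t : measurableTypeR R => (r + t : measurableTypeR R)).
  exact: measurable_funD.
have := @ge0_integral_pushforward _ _ (measurableTypeR R) (measurableTypeR R) R _ mr mu setT f measurableT mf (fun x _ => f0 x).
rewrite preimage_setT /comp /= => <-.
apply: eq_measure_integral => A mA _.
exact: lebesgue_measure_shift.
Qed.

Lemma normal_pdf_shift (s r t : R) : s != 0 ->
  normal_pdf r s (r + t) = normal_pdf 0 s t.
Proof. by move=> s0; rewrite !normal_pdfE// /normal_fun subr0 [r + t]addrC addrK. Qed.

Lemma normal_prob_shift (s r : R) (B : set R) : s != 0 -> measurable B ->
  normal_prob 0 s [set t | B (r + t)] = normal_prob r s B.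
Proof.
move=> s0 mB; rewrite /normal_prob integral_mkcond [RHS]integral_mkcond.
rewrite -[RHS](@ge0_integral_shift r); last 2 first.
- apply: (proj1 (measurable_restrictT _ mB)); apply/measurable_funTS.
  have mp : measurable_fun [set: R] (EFin \o normal_pdf r s).
    by apply/measurable_EFinP; exact: measurable_normal_pdf.
  exact: mp.
- move=> x; rewrite patchE; case: ifP => // _.
  by rewrite lee_fin normal_pdf_ge0.
apply: eq_integral => t _; rewrite !patchE normal_pdf_shift//.
Qed.

(** Bayes' formula for the density of a pair: [r] has variance [v] and [z] is [r] plus independent
    noise of variance [w]. On the right stand the density of [z] and the conditional density of [r]
    given [z]. *)
Lemma normal_pdf_mul (v w r z : R) : 0 < v -> 0 < w ->
  normal_pdf r (Num.sqrt w) z * normal_pdf 0 (Num.sqrt v) r =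
  normal_pdf 0 (Num.sqrt (v + w)) z *
  normal_pdf (z * v / (v + w)) (Num.sqrt (v * w / (v + w))) r.
Proof.
move=> v0 w0.
have vw0 : 0 < v + w by rewrite addr_gt0.
have x0 : 0 < v * w / (v + w) by rewrite divr_gt0// mulr_gt0.
rewrite !normal_pdfE ?sqrtr_eq0 -?ltNge//.
rewrite /normal_peak /normal_fun !sqr_sqrtr ?ltW// mulrACA [RHS]mulrACA.
have h : w * pi *+ 2 * (v * pi *+ 2) = (v + w) * pi *+ 2 * (v * w / (v + w) * pi *+ 2).
  by field; exact: lt0r_neq0.
rewrite -!invfM -!sqrtrM ?mulrn_wge0 ?mulr_ge0 ?pi_ge0 ?ltW// h.
congr (_ * _); rewrite -!expRD; congr expR; field.
by rewrite !lt0r_neq0.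
Qed.

Lemma integral_normal_pdfZ (k : \bar R) (m s : R) : (0 <= k)%E ->
  (\int[mu]_x (k * (normal_pdf m s x)%:E) = k)%E.
Proof.
move=> k0; rewrite ge0_integralZl//.
- by rewrite integral_normal_pdf mule1.
- by apply/measurable_EFinP; exact: measurable_normal_pdf.
- by move=> x _; rewrite lee_fin normal_pdf_ge0.
Qed.

(** After Tonelli's theorem, [normal_pdf_mul] isolates the variable [r] in a normal density, which
    integrates to 1. *)
Lemma normal_prob_add (v w : R) (B : set R) : 0 < v -> 0 < w -> measurable B ->
  (\int[normal_prob 0 (Num.sqrt v)]_r normal_prob 0 (Num.sqrt w) [set t | B (r + t)%R]
   = normal_prob 0 (Num.sqrt (v + w)) B)%E.
Proof.
move=> v0 w0 mB.
have vw0 : 0 < v + w by rewrite addr_gt0.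
have x0 : 0 < v * w / (v + w) by rewrite divr_gt0// mulr_gt0.
have sv0 : Num.sqrt v != 0 by rewrite sqrtr_eq0 -ltNge.
have sw0 : Num.sqrt w != 0 by rewrite sqrtr_eq0 -ltNge.
under eq_integral do rewrite normal_prob_shift//.
pose g (p : R * R) : R := \1_B p.2 * normal_pdf p.1 (Num.sqrt w) p.2.
pose f (p : R * R) : R := g p * normal_pdf 0 (Num.sqrt v) p.1.
have g0 p : 0 <= g p by rewrite /g mulr_ge0// normal_pdf_ge0.
have f0 p : 0 <= f p by rewrite /f mulr_ge0// normal_pdf_ge0.
have mg : measurable_fun [set: measurableTypeR R * measurableTypeR R] (EFin \o g).
  apply/measurable_EFinP; apply: measurable_funM; first by apply: measurableT_comp => //; exact: measurable_indic.
  rewrite (_ : (fun _ => _) = (fun p : R * R => normal_pdf 0 (Num.sqrt w) (p.2 - p.1))).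
    apply: measurableT_comp; first exact: measurable_normal_pdf.
    exact: measurable_funB.
  by apply/funext => p; rewrite -(normal_pdf_shift p.1 (p.2 - p.1) sw0) subrKC.
have mf : measurable_fun [set: measurableTypeR R * measurableTypeR R] (EFin \o f).
  apply/measurable_EFinP; apply: measurable_funM; first exact/measurable_EFinP.
  by apply: measurableT_comp => //; exact: measurable_normal_pdf.
have gE r : normal_prob r (Num.sqrt w) B = (\int[mu]_z (g (r, z))%:E)%E.
  rewrite /normal_prob integral_mkcond; apply: eq_integral => z _.
  by rewrite patchE /g indicE; case: ifP => zB; rewrite ?mul0r// mul1r.
have mG : measurable_fun [set: R] (fun r => normal_prob r (Num.sqrt w) B).
  rewrite (_ : (fun _ => _) = fun r => (\int[mu]_z (g (r, z))%:E)%E).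
    have g0E p : (0 <= (EFin \o g) p)%E by rewrite lee_fin g0.
    have h := measurable_fun_fubini_tonelli_F (m2 := mu) _ mg g0E.
    exact: h.
  by apply/funext => r; rewrite gE.
have mN m s' : measurable_fun [set: R] (fun x => (normal_pdf m s' x)%:E).
  by apply/measurable_EFinP; exact: measurable_normal_pdf.
have mI : measurable_fun [set: R] (fun x => (\1_B x : R)%:E).
  by apply/measurable_EFinP; exact: measurable_indic.
transitivity (\int[mu]_r \int[mu]_z (f (r, z))%:E)%E.
  rewrite ge0_integral_normal_prob; last 2 first.
  - exact: mG.
  - by [].
  apply: eq_integral => r _.
  rewrite /normal_prob integral_mkcond muleC -ge0_integralZl//; last 3 first.
  - by apply: (proj1 (measurable_restrictT _ mB)); apply/measurable_funTS; exact: mN.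
  - by move=> x _; rewrite patchE; case: ifP => // _; rewrite lee_fin normal_pdf_ge0.
  - by rewrite lee_fin normal_pdf_ge0.
  apply: eq_integral => z _; rewrite patchE /f /g /= indicE.
  by case: ifP => zB; rewrite ?mul0r ?mule0// mul1r muleC.
have f0E p : (0 <= (EFin \o f) p)%E by rewrite lee_fin f0.
have fT := fubini_tonelli (m1 := mu) (m2 := mu) _ mf f0E.
rewrite /= in fT; rewrite fT.
rewrite /normal_prob [RHS]integral_mkcond; apply: eq_integral => z _.
transitivity (\int[mu]_r ((\1_B z * normal_pdf 0 (Num.sqrt (v + w)) z)%:E *
    (normal_pdf (z * v / (v + w)) (Num.sqrt (v * w / (v + w))) r)%:E))%E.
  apply: eq_integral => r _; rewrite -EFinM; congr EFin.
  by rewrite -[RHS]mulrA -(normal_pdf_mul r z v0 w0) mulrA.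
have k0 : (0 <= (\1_B z * normal_pdf 0 (Num.sqrt (v + w)) z)%:E)%E.
  by rewrite lee_fin; apply: mulr_ge0; [rewrite indicE|exact: normal_pdf_ge0].
have -> : ((fun x => (normal_pdf 0 (Num.sqrt (v + w)) x)%:E) \_ B) z =
    (\1_B z * normal_pdf 0 (Num.sqrt (v + w)) z)%:E.
  by rewrite patchE indicE; case: ifP => _; rewrite ?mul0r ?mul1r.
move: (_%:E) k0 => k k0.
exact: integral_normal_pdfZ.
Qed.

Lemma measurable_gauss_shift (w : R) (B : set R) : measurable B ->
  measurable_fun [set: R] (fun r => gauss w [set t | B (r + t)%R]).
Proof.
move=> mB.
have mA : measurable [set p : measurableTypeR R * measurableTypeR R | B (p.1 + p.2)].
  have mD : measurable_fun setT (fun p : measurableTypeR R * measurableTypeR R => (p.1 + p.2 : measurableTypeR R)).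
    by apply: measurable_funD.
  by rewrite -[X in measurable X]setTI; exact: mD.
have := measurable_fun_xsection (gauss w) mA.
rewrite (_ : _ \o _ = fun r => gauss w [set t | B (r + t)%R])//.
apply/funext => r /=; congr (gauss w _).
by apply/seteqP; split => t /=; rewrite /xsection /= inE.
Qed.

Lemma gauss_add (v w : R) (B : set R) : 0 <= v -> 0 <= w -> measurable B ->
  (\int[gauss v]_r gauss w [set t | B (r + t)%R] = gauss (v + w) B)%E.
Proof.
move=> v0 w0 mB; have := measurable_gauss_shift w mB; rewrite /gauss paddr_eq0//.
have [->|vn0] := eqVneq v 0; rewrite /= ?add0r => mG.
  rewrite integral_dirac//= diracT mul1e; congr (_ _).
  by apply/seteqP; split => t /=; rewrite add0r.
have vgt0 : 0 < v by rewrite lt0r vn0.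
have [w_eq0|wn0] := eqVneq w 0; rewrite /= ?addr0; last by rewrite normal_prob_add// lt0r wn0.
rewrite w_eq0 addr0.
transitivity (\int[normal_prob 0 (Num.sqrt v)]_r (\1_B r)%:E)%E; last by rewrite integral_indic//= setIT.
apply: eq_integral => r _; rewrite /dirac /= !indicE; congr (_%:R)%:E.
by congr nat_of_bool; apply/idP/idP; rewrite !inE /= addr0.
Qed.

(** The product measure makes the two variables independent, so the law of their sum is the
    convolution computed by [gauss_add]. *)
Lemma centered_gaussian_add d1 d2 (T1 : measurableType d1) (T2 : measurableType d2)
    (P1 : probability T1 R) (P2 : probability T2 R) (v w : R)
    (X : T1 -> R) (Y : T2 -> R) :
  measurable_fun setT X -> measurable_fun setT Y ->
  centered_gaussian P1 v X -> centered_gaussian P2 w Y ->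
  centered_gaussian (P1 \x P2)%E (v + w) (fun p => X p.1 + Y p.2).
Proof.
move=> mX mY [v0 XE] [w0 YE]; split; first exact: addr_ge0.
move=> B mB.
rewrite -gauss_add//.
rewrite -(@ge0_integral_law _ _ _ P1 (gauss v) X (fun r => gauss w [set t | B (r + t)%R])
  mX XE (measurable_gauss_shift w mB) (fun r => measure_ge0 _ _)).
rewrite /product_measure1; apply: eq_integral => x _ /=.
rewrite -YE; last first.
  have mD : measurable_fun setT (fun t : R => X x + t) by exact: measurable_funD.
  by rewrite -[X in measurable X]setTI; exact: mD.
by congr (P2 _); apply/seteqP; split => t /=; rewrite /xsection /= inE.
Qed.

End convolution.

(** * The Cramer-Wold theorem *)

Section sign_approximation.
Context (R : realType).
Implicit Types (x y t : R) (k : nat).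

(* The iterates of q |-> q (3 - q^2) / 2 tend to the sign on [-1, 1]. As they are
   polynomials, they map trigonometric sums to trigonometric sums. *)
Fixpoint sgn_approx k y : R :=
  if k is k'.+1 then let q := sgn_approx k' y in q * (3 - q ^+ 2) / 2 else y.

Lemma sgn_approxN k y : sgn_approx k (- y) = - sgn_approx k y.
Proof. by elim: k => //= k ->; rewrite sqrrN !mulNr. Qed.

Lemma sgn_approx0 k : sgn_approx k 0 = 0.
Proof. by elim: k => //= k ->; rewrite !mul0r. Qed.

(** One iteration multiplies the distance [1 - q] by [1 - q / 2 - q ^+ 2 / 2], which is at most
    [1 - y / 2] because the iterates stay above [y]. *)
Lemma sgn_approx_bnd k y : 0 <= y <= 1 ->
  y <= sgn_approx k y <= 1 /\ 1 - sgn_approx k y <= (1 - y / 2) ^+ k.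
Proof.
move=> /andP[y0 y1]; elim: k => [|k [/andP[h1 h2] h3]] /=.
  by rewrite expr0 lexx y1; split => //; lra.
set q := sgn_approx k y in h1 h2 h3 *.
have h4 : q * (3 - q ^+ 2) / 2 <= 1.
  have -> : q * (3 - q ^+ 2) / 2 = 1 - (1 - q) ^+ 2 * (2 + q) / 2 by field.
  by rewrite lerBlDr lerDl divr_ge0// mulr_ge0 ?sqr_ge0//; lra.
have h5 : q <= q * (3 - q ^+ 2) / 2.
  have -> : q * (3 - q ^+ 2) / 2 = q + q * ((1 - q) * (1 + q)) / 2 by field.
  by rewrite lerDl divr_ge0// !mulr_ge0//; lra.
rewrite h4 (le_trans h1 h5); split => //.
have h6 : 1 - q * (3 - q ^+ 2) / 2 <= (1 - q) * (1 - y / 2).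
  have -> : 1 - q * (3 - q ^+ 2) / 2 = (1 - q) * (1 - q / 2 - q ^+ 2 / 2) by field.
  by rewrite ler_wpM2l//; [lra|have := sqr_ge0 q; lra].
by apply: (le_trans h6); rewrite [leRHS]exprSr; apply: ler_wpM2r => //; lra.
Qed.

Lemma sgn_approx_cvg y : 0 < y <= 1 -> sgn_approx k y @[k --> \oo] --> (1 : R).
Proof.
move=> /andP[y0 y1].
have yb : 0 <= y <= 1 by rewrite ltW.
have h : 1 - (1 - y / 2) ^+ k @[k --> \oo] --> (1 : R).
  rewrite -[X in _ --> X]subr0; apply: cvgB; first exact: cvg_cst.
  by apply: cvg_expr; rewrite ger0_norm; lra.
apply: (squeeze_cvgr _ h); last exact: cvg_cst.
apply: nearW => k; have [/andP[_ ->] h2] := sgn_approx_bnd k yb.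
by rewrite andbT; lra.
Qed.

(** The polynomial [(q + q ^+ 2) / 2] sends the signs -1, 0, 1 to 0, 0, 1, hence the limit is the
    indicator of [0 < y]. *)
Definition pos_approx k y : R := (sgn_approx k y + sgn_approx k y ^+ 2) / 2.

Lemma pos_approx_bnd k y : -1 <= y <= 1 -> `|pos_approx k y| <= 1.
Proof.
move=> /andP[y0 y1]; rewrite /pos_approx.
have : -1 <= sgn_approx k y <= 1.
  have [y_ge0|/ltW y_le0] := leP 0 y.
    have [|/andP[h1 h2] _] := @sgn_approx_bnd k y; first exact/andP.
    by apply/andP; split; lra.
  have [|/andP[h1 h2] _] := @sgn_approx_bnd k (- y); first by apply/andP; split; lra.
  by rewrite sgn_approxN in h1 h2; apply/andP; split; lra.
move: (sgn_approx k y) => q /andP[q1 q2].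
by rewrite ler_norml; apply/andP; split; nra.
Qed.

Lemma pos_approx_cvg y : -1 <= y <= 1 ->
  pos_approx^~ y @ \oo --> ((0 < y)%R%:R : R).
Proof.
move=> /andP[y0 y1]; rewrite /pos_approx.
have [y_gt0|y_lt0|<-] := ltgtP 0 y.
- have h := sgn_approx_cvg (_ : 0 < y <= 1).
  have {}h := h ltac:(exact/andP).
  rewrite [X in _ --> X](_ : _ = (1 + 1 ^+ 2) / 2); last by rewrite /=; field.
  apply: cvgM; last exact: cvg_cst.
  by apply: cvgD => //; rewrite expr2; under eq_fun do rewrite expr2; apply: cvgM.
- have h := sgn_approx_cvg (_ : 0 < - y <= 1).
  have {}h := h ltac:(apply/andP; split; lra).
  have {}h : sgn_approx k y @[k --> \oo] --> (-1 : R).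
    rewrite -[y]opprK; under eq_fun do rewrite sgn_approxN.
    exact: cvgN.
  rewrite [X in _ --> X](_ : _ = (-1 + (-1) ^+ 2) / 2); last by rewrite /=; field.
  apply: cvgM; last exact: cvg_cst.
  by apply: cvgD => //; rewrite expr2; under eq_fun do rewrite expr2; apply: cvgM.
- under eq_fun do rewrite sgn_approx0 expr0n /= addr0 mul0r.
  exact: cvg_cst.
Qed.

Lemma near_sin_gt0 x : \forall k \near \oo, (0 < sin (x / k.+1%:R)) = (0 < x).
Proof.
have pos (z : R) : 0 < z -> \forall k \near \oo, 0 < sin (z / k.+1%:R).
  move=> z0; near=> k.
  apply: sin_gt0_pi; rewrite divr_gt0//= ltr_pdivrMr//.
  have : z < k%:R by near: k; exact: nbhs_infty_gtr.
  move=> zk; apply: (lt_le_trans zk).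
  have := @pi_ge2 R => pi2.
  have k0 : (0 : R) <= k%:R by [].
  have pik : 2 * k%:R <= pi * k%:R :> R by rewrite ler_wpM2r.
  by rewrite -natr1 mulrDr mulr1; lra.
have [x0|x0|<-] := ltgtP 0 x.
- by near=> k; near: k; exact: pos.
- have : 0 < - x by rewrite oppr_gt0.
  move=> /pos h; near=> k; apply/negbTE; rewrite -leNgt ltW//.
  by rewrite -oppr_gt0 -sinN -mulNr; near: k.
- by near=> k; rewrite mul0r sin0 ltxx.
Unshelve. all: by end_near. Qed.

End sign_approximation.

Section cramer_wold.
Context (R : realType) (n : nat).
Variables m1 m2 : probability (n.-tuple R) R.
Implicit Types (f g : n.-tuple R -> R) (a : 'I_n -> R) (x : n.-tuple R).

Hypothesis m12 : forall a (B : set R), measurable B ->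
  m1 [set x | B (\sum_i a i * tnth x i)] = m2 [set x | B (\sum_i a i * tnth x i)].

(** Test functions on which the two laws agree. The class is closed under linear combinations and
    uniformly bounded pointwise limits; the aim is to bring indicators of orthants into it. *)
Let same f := [/\ measurable_fun setT f, (exists M : R, forall x, `|f x| <= M) &
  (\int[m1]_x (f x)%:E = \int[m2]_x (f x)%:E)%E].

Let bounded_int (m : probability (n.-tuple R) R) f : measurable_fun setT f ->
  (exists M : R, forall x, `|f x| <= M) -> m.-integrable setT (EFin \o f).
Proof.
move=> mf [M fM]; apply: (@le_integrable _ _ _ m _ measurableT _ (cst M%:E)).
- exact/measurable_EFinP.
- by move=> x _; rewrite lee_fin (le_trans (fM x))// ler_norm.
- exact: finite_measure_integrable_cst.
Qed.

Let sameD f g : same f -> same g -> same (fun x => f x + g x).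
Proof.
move=> [mf bf fE] [mg bg gE]; split.
- exact: measurable_funD.
- move: bf bg => [M fM] [N gN]; exists (M + N) => x.
  by rewrite (le_trans (ler_normD _ _))// lerD.
- under eq_integral do rewrite EFinD.
  under [RHS]eq_integral do rewrite EFinD.
  rewrite !integralD//=; [by rewrite fE gE|..]; exact: bounded_int.
Qed.

Let sameZ c f : same f -> same (fun x => c * f x).
Proof.
move=> [mf bf fE]; split.
- exact: measurable_funM.
- move: bf => [M fM]; exists (`|c| * M) => x.
  by rewrite normrM ler_wpM2l.
- under eq_integral do rewrite EFinM.
  under [RHS]eq_integral do rewrite EFinM.
  rewrite !integralZl//=; [by rewrite fE|..]; exact: bounded_int.
Qed.

Let same_lim (f_ : nat -> n.-tuple R -> R) f (M : R) :
  (forall k, same (f_ k)) -> (forall k x, `|f_ k x| <= M) ->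
  (forall x, f_ k x @[k --> \oo] --> f x) -> same f.
Proof.
move=> sf fM fl.
have mf : measurable_fun setT f.
  by apply: (@measurable_fun_cvg _ _ _ _ f_) => [k|x _]; [have [] := sf k|].
have fb x : `|f x| <= M.
  have h : (Num.norm \o f_ ^~ x) @ \oo --> `|f x| by apply: cvg_norm.
  rewrite -(cvg_lim _ h)//; apply: limr_le; first by apply/cvg_ex; exists `|f x|.
  by apply: nearW => k /=.
split => //; first by exists M.
have dct (m : probability (n.-tuple R) R) :
    (\int[m]_x (f_ k x)%:E)%E @[k --> \oo] --> (\int[m]_x (f x)%:E)%E.
  apply: (@dominated_cvg _ _ _ m _ measurableT (fun k x => (f_ k x)%:E) _ (cst M%:E)) => //.
  - by move=> k; apply/measurable_EFinP; have [] := sf k.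
  - by move=> x _; apply: cvg_EFin; [exact: nearW|exact: fl].
  - exact: finite_measure_integrable_cst.
  - by move=> k x _; rewrite lee_fin.
have d1 := dct m1; have d2 := dct m2.
rewrite -(cvg_lim _ d1)// -(cvg_lim _ d2)//; congr (lim (_ @ \oo)).
by apply/funext => k; have [] := sf k.
Qed.

(** The mean of a generator depends only on the law of one linear form, which is what [m12]
    controls. The phase [b] brings in sines, and the product-to-sum formula makes the class an
    algebra, so polynomials in sines stay in it. *)
Inductive trig : (n.-tuple R -> R) -> Prop :=
| trig_cos a b : trig (fun x => cos (\sum_i a i * tnth x i + b))
| trig_add f g : trig f -> trig g -> trig (fun x => f x + g x)
| trig_scale c f : trig f -> trig (fun x => c * f x).

Let meas_lin a : measurable_fun [set: n.-tuple R] (fun x => \sum_i a i * tnth x i).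
Proof.
apply: measurable_sum => i; apply: measurable_funM => //; exact: measurable_tnth.
Qed.

Let trig_same f : trig f -> same f.
Proof.
elim => [a b|{}f g _ sf _ sg|c {}f _ sf]; [|exact: sameD|exact: sameZ].
have mc : measurable_fun [set: R] (fun y : R => cos (y + b)).
  apply: continuous_measurable_fun => y.
  by apply: continuous_comp; [apply: cvgD; [exact: cvg_id|exact: cvg_cst]|exact: continuous_cos].
have mL := meas_lin a.
split.
- exact: (measurableT_comp mc mL).
- by exists 1 => x; rewrite ler_norml cos_geN1 cos_le1.
- have E (m : probability (n.-tuple R) R) : (\int[m]_x (cos (\sum_i a i * tnth x i + b))%:E =
    \int[pushforward m (fun x => (\sum_i a i * tnth x i)%R : measurableTypeR R)]_(y in setT) (cos (y + b))%:E)%E.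
    rewrite (integral_pushforward (phi := fun x => (\sum_i a i * tnth x i)%R : measurableTypeR R))//=.
      exact/measurable_EFinP.
    rewrite preimage_setT; apply: bounded_int => //.
      exact: (measurableT_comp mc mL).
    by exists 1 => x; rewrite ler_norml cos_geN1 cos_le1.
  by rewrite !E; apply: eq_measure_integral => A mA _; exact: m12.
Qed.

Let trig_mul f g : trig f -> trig g -> trig (fun x => f x * g x).
Proof.
move=> tf; elim: tf g => [a b|f1 f2 _ h1 _ h2|c f1 _ h1] g tg.
- elim: tg => [a' b'|g1 g2 _ h1 _ h2|c g1 _ h1].
  + rewrite (_ : (fun _ => _) = fun x =>
      2^-1 * (cos (\sum_i (a i + a' i) * tnth x i + (b + b'))) +
      2^-1 * (cos (\sum_i (a i - a' i) * tnth x i + (b - b')))).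
      by apply: trig_add; apply: trig_scale; exact: trig_cos.
    apply/funext => x.
    under [X in _ = _ * cos (X + _) + _]eq_bigr do rewrite mulrDl.
    under [X in _ = _ + _ * cos (X + _)]eq_bigr do rewrite mulrBl.
    rewrite big_split sumrB /=.
    set A := \sum_i a i * _; set A' := \sum_i a' i * _.
    have -> : A + A' + (b + b') = (A + b) + (A' + b') by ring.
    have -> : A - A' + (b - b') = (A + b) - (A' + b') by ring.
    by move: (A + b) (A' + b') => u w; rewrite cosD cosB; field.
  + by under eq_fun do rewrite mulrDr; exact: trig_add.
  + by under eq_fun do rewrite mulrCA; exact: trig_scale.
- by under eq_fun do rewrite mulrDl; apply: trig_add; [exact: h1|exact: h2].
- by under eq_fun do rewrite -mulrA; apply: trig_scale; exact: h1.
Qed.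

Let trig_cst c : trig (fun=> c).
Proof.
rewrite (_ : (fun=> _) = fun x => c * cos (\sum_i 0 * tnth x i + 0)).
  by apply: trig_scale; exact: trig_cos.
by apply/funext => x; rewrite big1 ?addr0 ?cos0 ?mulr1// => i _; rewrite mul0r.
Qed.

Let trig_sin i t c : trig (fun x => sin ((tnth x i - t) / c)).
Proof.
rewrite (_ : (fun _ => _) = fun x => cos (\sum_j ((j == i)%:R / c) * tnth x j + (- t / c - pi / 2))).
  exact: trig_cos.
apply/funext => x; rewrite (bigD1 i)//= eqxx big1 ?addr0.
  rewrite -cosBpihalf; congr cos; rewrite [true%:R]mulr1n; ring.
by move=> j /negbTE ->; rewrite !mul0r.
Qed.

Let trig_sgn k f : trig f -> trig (fun x => sgn_approx k (f x)).
Proof.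
move=> tf; elim: k => //= k ih.
rewrite (_ : (fun _ => _) = fun x => 2^-1 * (sgn_approx k (f x) *
   (3 + (-1) * (sgn_approx k (f x) * sgn_approx k (f x))))); last first.
  by apply/funext => x; field.
apply: trig_scale; apply: (trig_mul ih); apply: (trig_add (trig_cst _)).
by apply: trig_scale; exact: trig_mul.
Qed.

Let trig_pos k f : trig f -> trig (fun x => pos_approx k (f x)).
Proof.
move=> tf; have ts := trig_sgn k tf.
rewrite (_ : (fun _ => _) = fun x => 2^-1 * (sgn_approx k (f x) +
   (sgn_approx k (f x) * sgn_approx k (f x)))); last first.
  by apply/funext => x; rewrite /pos_approx; field.
by apply: trig_scale; apply: (trig_add ts); exact: trig_mul.
Qed.

Let trig_prod (I : Type) (r : seq I) (F : I -> n.-tuple R -> R) :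
  (forall i, trig (F i)) -> trig (fun x => \prod_(i <- r) F i x).
Proof.
move=> tF; elim: r => [|i r ih].
  by under eq_fun do rewrite big_nil; exact: trig_cst.
by under eq_fun do rewrite big_cons; exact: trig_mul.
Qed.

Let prod_norm_le1 (I : Type) (r : seq I) (F : I -> R) :
  (forall i, `|F i| <= 1) -> `|\prod_(i <- r) F i| <= 1.
Proof.
move=> F1; elim: r => [|i r ih]; first by rewrite big_nil normr1.
by rewrite big_cons normrM mulr_ile1.
Qed.

(* For L large, sin ((x_i - t_i) / L) has the sign of x_i - t_i. *)
Let same_orthant (t : 'I_n -> R) :
  same (fun x => \prod_i (t i < tnth x i)%R%:R).
Proof.
have same1 L : same (fun x => \prod_i (0 < sin ((tnth x i - t i) / L))%R%:R).
  apply: (@same_lim (fun k x => \prod_i pos_approx k (sin ((tnth x i - t i) / L))) _ 1).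
  - by move=> k; apply: trig_same; apply: trig_prod => i; apply: trig_pos; exact: trig_sin.
  - move=> k x; apply: prod_norm_le1 => i; apply: pos_approx_bnd.
    by rewrite sin_geN1 sin_le1.
  - move=> x; apply: cvg_big => [|i _]; first exact: mul_continuous.
    by apply: pos_approx_cvg; rewrite sin_geN1 sin_le1.
apply: (@same_lim (fun k x => \prod_i (0 < sin ((tnth x i - t i) / k.+1%:R))%R%:R) _ 1).
- by move=> k; exact: same1.
- by move=> k x; apply: prod_norm_le1 => i; case: (_ < _)%R; rewrite ?normr1 ?normr0.
- move=> x; apply: cvg_big => [|i _]; first exact: mul_continuous.
  apply: cvg_near_cst; near=> k.
  have -> : (0 < sin ((tnth x i - t i) / k.+1%:R)) = (t i < tnth x i).
    by rewrite -(subr_gt0 (t i)); near: k; exact: near_sin_gt0.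
  by [].
Unshelve. all: by end_near. Qed.

Let orthant (t : 'I_n -> R) : set (n.-tuple R) := [set x | forall i, t i < tnth x i].

Let prod_orthant (t : 'I_n -> R) x : \prod_i (t i < tnth x i)%R%:R = \1_(orthant t) x :> R.
Proof.
rewrite indicE; case: (boolP (x \in _)) => [/set_mem xt|/negP xt].
  by rewrite big1// => i _; rewrite xt.
have [i xi] : exists i, ~~ (t i < tnth x i).
  apply: contrapT => h; apply: xt; apply/mem_set => i.
  by apply: contrapT => /negP xi; apply: h; exists i.
by rewrite (bigD1 i)//= (negbTE xi) mul0r.
Qed.

Let measurable_orthant t : measurable (orthant t).
Proof.
have [mf _ _] := same_orthant t.
have -> : orthant t = (fun x => \prod_i (t i < tnth x i)%R%:R) @^-1` [set (1 : R)].
  apply/seteqP; split => x /=; rewrite prod_orthant indicE.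
    by move=> xt; rewrite mem_set.
  by case: (boolP (x \in _)) => [/set_mem//|_] /esym/eqP; rewrite oner_eq0.
by rewrite -[X in measurable X]setTI; exact: (mf measurableT _ (measurable_set1 _)).
Qed.

Let orthantE t : m1 (orthant t) = m2 (orthant t).
Proof.
have [_ _] := same_orthant t.
under eq_integral do rewrite prod_orthant.
under [RHS]eq_integral do rewrite prod_orthant.
by rewrite !integral_indic ?setIT.
Qed.

Let tuple_lower_bound x : exists k : nat, forall j, - k%:R < tnth x j.
Proof.
exists (\max_j Num.bound `|tnth x j|) => j.
have h := archi_boundP (normr_ge0 (tnth x j)).
rewrite ltrNl (le_lt_trans (ler_norm _))// normrN (lt_le_trans h)//.
by rewrite ler_nat (leq_bigmax j).
Qed.

Let G : set (set (n.-tuple R)) := [set A | exists t, A = orthant t].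

(** A half-space on one coordinate is the countable union of the orthants whose other bounds are
    [- k]; half-lines generate the Borel sets of each coordinate. *)
Let measurable_tupleE : @measurable _ (n.-tuple R) = <<s G >>.
Proof.
apply/seteqP; split; last first.
  apply: smallest_sub; first exact: sigma_algebra_measurable.
  by move=> _ [t ->]; exact: measurable_orthant.
apply: smallest_sub; first exact: smallest_sigma_algebra.
rewrite -bigcup_seq => A /= [i _ [B mB <-]].
have mi : measurable_fun [set: g_sigma_algebraType G] (fun x : g_sigma_algebraType G => (tnth (x : n.-tuple R) i : measurableTypeR R)).
  apply: (measurability _ (RGenOInfty.measurableE R)).
  move=> _ [_ [r ->] <-]; rewrite setTI.
  have -> : (fun x : g_sigma_algebraType G => (tnth (x : n.-tuple R) i : measurableTypeR R)) @^-1` `]r, +oo[%classic =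
      \bigcup_k (orthant (fun j => if j == i then r else - k%:R)).
    apply/seteqP; split => [x /=|x [k _ xk] /=]; rewrite in_itv/= andbT.
      move=> rx.
      have [k xk] := tuple_lower_bound x.
      by exists k => // j; case: eqP => [->|_].
    by have := xk i; rewrite eqxx.
  by apply: bigcupT_measurable => k; apply: sub_sigma_algebra; eexists.
exact: (mi measurableT B mB).
Qed.

(** Orthants form a generating class stable under intersection, by coordinatewise maximum of the
    bounds, and countably many of them exhaust the space, so two finite measures equal on them
    coincide. *)
Theorem cramer_wold A : measurable A -> m1 A = m2 A.
Proof.
apply: (measure_unique G (fun k => orthant (fun=> - k%:R))).
- exact: measurable_tupleE.
- move=> _ _ [t ->] [u ->]; exists (fun i => Num.max (t i) (u i)).
  apply/seteqP; split => x /=.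
    by move=> [xt xu] i; rewrite gt_max xt xu.
  by move=> h; split => i; have := h i; rewrite gt_max => /andP[].
- by move=> k; eexists.
- apply/seteqP; split => // x _.
  by have [k xk] := tuple_lower_bound x; exists k.
- by move=> _ [t ->]; exact: orthantE.
- by move=> k; rewrite (le_lt_trans (probability_le1 _ _))// ltry.
Qed.

End cramer_wold.

(** * The Maurey-Pisier inequality *)

Section elementary.
Context (R : realType).
Implicit Types x : R.

Lemma sin_le_id x : 0 <= x -> sin x <= x.
Proof.
rewrite le_eqVlt => /predU1P[<-|x0]; first by rewrite sin0.
have [c _] := @MVT R sin cos 0 x x0 (fun y _ => is_derive_sin y) (continuous_subspaceT (@continuous_sin R)).
by rewrite sin0 !subr0 => ->; rewrite ler_piMl ?cos_le1// ltW.
Qed.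

Lemma one_sub_cos_le x : 0 <= x <= pi -> 1 - cos x <= x ^+ 2 / 2.
Proof.
move=> /andP[x0 xpi].
have h := @sin_le_id (x / 2) (_ : 0 <= x / 2).
have {}h := h ltac:(lra).
have s0 : 0 <= sin (x / 2) by apply: sin_ge0_pi; apply/andP; split; lra.
have -> : cos x = 1 - 2 * sin (x / 2) ^+ 2.
  have {1}-> : x = (x / 2) *+ 2 by rewrite mulr2n; field.
  by rewrite cos_mulr2n cos2sin2; ring.
have -> : x ^+ 2 / 2 = 2 * (x / 2) ^+ 2 by field.
have : sin (x / 2) ^+ 2 <= (x / 2) ^+ 2 by rewrite lerXn2r// nnegrE; lra.
lra.
Qed.

(** Jensen's inequality for the uniform average of [n.+1%:R * a i], by summing the tangent
    inequalities at its mean [m]. *)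
Lemma expR_mean (n : nat) (a : 'I_n.+1 -> R) :
  expR (\sum_i a i) <= n.+1%:R^-1 * \sum_i expR (n.+1%:R * a i).
Proof.
set m := \sum_i a i.
rewrite ler_pdivlMl//.
apply: (@le_trans _ _ (\sum_(i < n.+1) expR m * (1 + n.+1%:R * a i - m))).
  rewrite -mulr_sumr big_split/= big_split/= -mulr_sumr sumr_const card_ord -/m.
  by rewrite mulrC sumr_const card_ord -[- m *+ _]mulr_natl mulrN addrK.
by apply: ler_sum => i _; exact: expR_tangent.
Qed.

End elementary.

(** * Rotation invariance of two independent copies *)

Section rotation.
Context d (T : measurableType d) (R : realType) (P : probability T R) (N : nat).
Variables (X : 'I_N -> T -> R) (K : 'I_N -> 'I_N -> R).
Hypothesis mX : forall i, measurable_fun setT (X i).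
Hypothesis gX : forall a : 'I_N -> R,
  centered_gaussian P (\sum_i \sum_j a i * a j * K i j) (fun w => \sum_i a i * X i w).

Let q (a : 'I_N -> R) := \sum_i \sum_j a i * a j * K i j.

(** For [s] and [c] the sine and cosine of an angle, the two halves are the rotated family and its
    derivative in the angle. A further rotation is a linear function of both halves, so their joint
    law is needed. *)
Definition rotated (s c : R) (p : T * T) : (N + N).-tuple R :=
  [tuple match fintype.split k with
         | inl i => s * X i p.1 + c * X i p.2
         | inr i => c * X i p.1 - s * X i p.2
         end | k < (N + N)%N].

Lemma rotated_lshift s c p i : tnth (rotated s c p) (lshift N i) =
  s * X i p.1 + c * X i p.2.
Proof. by rewrite tnth_mktuple (unsplitK (inl _ i)). Qed.

Lemma rotated_rshift s c p i : tnth (rotated s c p) (rshift N i) =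
  c * X i p.1 - s * X i p.2.
Proof. by rewrite tnth_mktuple (unsplitK (inr _ i)). Qed.

Let mX1 i : measurable_fun [set: T * T] (fun p => X i p.1).
Proof. exact: (measurableT_comp (mX i)). Qed.

Let mX2 i : measurable_fun [set: T * T] (fun p => X i p.2).
Proof. exact: (measurableT_comp (mX i)). Qed.

Lemma measurable_rotated s c : measurable_fun setT (rotated s c).
Proof.
apply/measurable_fun_tnthP => k.
rewrite (_ : _ \o _ = fun p => match fintype.split k with
   | inl i => s * X i p.1 + c * X i p.2 | inr i => c * X i p.1 - s * X i p.2 end).
  case: fintype.split => i; [apply: measurable_funD|apply: measurable_funB]; exact: measurable_funM.
by apply/funext => p /=; rewrite tnth_mktuple.
Qed.

(** Regrouped by copies, the combination has coefficients [a1] and [a2]; the cross terms of [q a1]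
    and [q a2] cancel and the squares recombine by [s ^+ 2 + c ^+ 2 = 1]. The variance is therefore
    free of the angle. *)
Lemma rotated_gaussian s c (a : 'I_(N + N) -> R) : s ^+ 2 + c ^+ 2 = 1 ->
  centered_gaussian (P \x P)%E (q (a \o lshift N) + q (a \o @rshift N N))
    (fun p => \sum_k a k * tnth (rotated s c p) k).
Proof.
move=> sc.
pose a1 i := s * a (lshift N i) + c * a (rshift N i).
pose a2 i := c * a (lshift N i) - s * a (rshift N i).
have -> : q (a \o lshift N) + q (a \o @rshift N N) = q a1 + q a2.
  rewrite /q -!big_split; apply: eq_bigr => i _; rewrite /= -!big_split.
  apply: eq_bigr => j _ /=; rewrite /a1 /a2.
  rewrite -[LHS]mul1r -sc; ring.
have -> : (fun p => \sum_k a k * tnth (rotated s c p) k) =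
  (fun p : T * T => \sum_i a1 i * X i p.1 + \sum_i a2 i * X i p.2).
  apply/funext => p; rewrite big_split_ord/= -!big_split/=; apply: eq_bigr => i _.
  by rewrite rotated_lshift rotated_rshift /a1 /a2; ring.
have mS (b : 'I_N -> R) : measurable_fun setT (fun w => \sum_i b i * X i w).
  by apply: measurable_sum => i; exact: measurable_funM.
exact: centered_gaussian_add (mS a1) (mS a2) (gX a1) (gX a2).
Qed.

(** All linear combinations of the tuple have laws free of the angle, hence by Cramer-Wold so has
    the tuple itself; [rotated 1 0] serves as reference. *)
Lemma ge0_integral_rotated s c (G : (N + N).-tuple R -> \bar R) :
  s ^+ 2 + c ^+ 2 = 1 -> measurable_fun setT G -> (forall x, (0 <= G x)%E) ->
  (\int[P \x P]_p G (rotated s c p) = \int[P \x P]_p G (rotated 1 0 p))%E.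
Proof.
move=> sc mG G0.
have sc1 : 1 ^+ 2 + 0 ^+ 2 = 1 :> R by rewrite expr1n expr0n addr0.
pose mk s c : {RV (P \x P)%E >-> (N + N).-tuple R} :=
  HB.pack (rotated s c) (isMeasurableFun.Build _ _ _ _ _ (measurable_rotated s c)).
have E s' c' : (\int[P \x P]_p G (rotated s' c' p) =
    \int[distribution (P \x P)%E (mk s' c')]_x G x)%E.
  by rewrite ge0_integral_distribution.
rewrite !E; apply: eq_measure_integral => A mA _.
apply: (cramer_wold _ mA) => a B mB; rewrite /distribution /pushforward /=.
have [_ h1] := rotated_gaussian a sc; have [_ h2] := rotated_gaussian a sc1.
exact: etrans (h1 B mB) (esym (h2 B mB)).
Qed.

End rotation.

(** * Maxima of finitely many affine functionals *)

Section affine_max.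
Context (R : realType) (n : nat) (kappa : 'I_n.+1 -> R).
Implicit Types (x y : 'I_n.+1 -> R).

(** The default of the iterated maximum is one of the terms, so it does not alter the maximum. *)
Definition affine_max x : R :=
  \big[Num.max/x ord0 - kappa ord0]_i (x i - kappa i).

Lemma affine_max_ge x i : x i - kappa i <= affine_max x.
Proof. exact: le_bigmax. Qed.

(* [argmax j x] is the indicator that [j] is the first index attaining the maximum. *)
Definition argmax (j : 'I_n.+1) x : R :=
  (\prod_i (x i - kappa i <= x j - kappa j)%R%:R) *
  (\prod_(i < n.+1 | (i < j)%N) (x i - kappa i < x j - kappa j)%R%:R).

Lemma prod_bool (I : finType) (Q : pred I) (b : I -> bool) :
  \prod_(i | Q i) (b i)%:R = [forall (i | Q i), b i]%:R :> R.
Proof.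
case: (boolP [forall (i | Q i), b i]) => [/forall_inP h|/forall_inPn[i Qi /negbTE bi]].
  by rewrite big1// => i /h ->.
by rewrite (bigD1 i)//= bi mul0r.
Qed.

Lemma argmaxE j x : argmax j x =
  ([forall i, x i - kappa i <= x j - kappa j] &&
   [forall (i : 'I_n.+1 | (i < j)%N), x i - kappa i < x j - kappa j])%:R.
Proof. by rewrite /argmax !prod_bool -natrM mulnb. Qed.

Lemma argmax_ge0 j x : 0 <= argmax j x.
Proof. by rewrite argmaxE. Qed.

Lemma affine_max_argmax j x : argmax j x != 0 -> affine_max x = x j - kappa j.
Proof.
rewrite argmaxE pnatr_eq0 eqb0 negbK => /andP[/forallP h _].
apply/eqP; rewrite eq_le affine_max_ge andbT.
by apply/bigmax_leP; split.
Qed.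

Lemma affine_max_attained x : exists i, affine_max x = x i - kappa i.
Proof.
case: (arg_maxP (P := xpredT) (fun i => x i - kappa i) (i0 := ord0)) => // i _ iP.
exists i; apply/eqP; rewrite eq_le affine_max_ge andbT.
by apply/bigmax_leP; split => [|j _]; exact: iP.
Qed.

Lemma sum_argmax x : \sum_j argmax j x = 1.
Proof.
have [i0 i0E] := affine_max_attained x.
have [|j /eqP jE jmin] := @arg_minnP _ i0 (fun j => x j - kappa j == affine_max x) (@nat_of_ord _).
  by rewrite i0E.
rewrite (bigD1 j)//= big1 ?addr0 => [|i ij].
  rewrite argmaxE (_ : _ && _ = true)//; apply/andP; split.
    by apply/forallP => i; rewrite jE affine_max_ge.
  apply/forall_inP => i ij; rewrite jE lt_neqAle affine_max_ge andbT.
  by apply/negP => /jmin; rewrite leqNgt ij.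
apply/eqP; apply: contraT => Ai.
have iE := affine_max_argmax Ai.
have : (j <= i)%N by apply: jmin; rewrite iE.
rewrite leq_eqVlt => /predU1P[/val_inj ji|ji]; first by rewrite ji eqxx in ij.
move: Ai; rewrite argmaxE pnatr_eq0 eqb0 negbK => /andP[_ /forall_inP /(_ _ ji)].
by rewrite jE iE ltxx.
Qed.

End affine_max.

Section measurability.
Context d (T : measurableType d) (R : realType) (n : nat) (kappa : 'I_n.+1 -> R).
Variable Y : 'I_n.+1 -> T -> R.
Hypothesis mY : forall i, measurable_fun setT (Y i).

Let mYk i : measurable_fun setT (fun w => Y i w - kappa i).
Proof. exact: measurable_funB. Qed.

Lemma measurable_affine_max :
  measurable_fun setT (fun w => affine_max kappa (Y ^~ w)).
Proof.
rewrite /affine_max; elim: (index_enum _) => [|i r ih].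
  by under eq_fun do rewrite big_nil; exact: mYk.
under eq_fun do rewrite big_cons /=.
exact: (measurable_maxr (mYk i) ih).
Qed.

Lemma measurable_argmax j : measurable_fun setT (fun w => argmax kappa j (Y ^~ w)).
Proof.
have mb (b : T -> bool) : measurable_fun setT b -> measurable_fun setT (fun w => (b w)%:R : R).
  by move=> mb; apply: (measurableT_comp (f := fun b : bool => b%:R : R)).
apply: measurable_funM.
  by apply: measurable_prod => i _; apply: mb; exact: measurable_fun_ler.
under eq_fun do rewrite big_mkcond.
apply: measurable_prod => i _; case: (_ < _)%N => //.
by apply: mb; exact: measurable_fun_ltr.
Qed.

End measurability.

Section maurey_pisier.
Context d (T : measurableType d) (R : realType) (P : probability T R) (n : nat).
Variables (X : 'I_n.+1 -> T -> R) (K : 'I_n.+1 -> 'I_n.+1 -> R) (v : R).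
Variable kappa : 'I_n.+1 -> R.
Hypothesis mX : forall i, measurable_fun setT (X i).
Hypothesis gX : forall a : 'I_n.+1 -> R,
  centered_gaussian P (\sum_i \sum_j a i * a j * K i j) (fun w => \sum_i a i * X i w).
Hypothesis Kv : forall i, K i i <= v.

Let F := affine_max kappa.

Lemma coordinate_mgf i l :
  (\int[P]_w (expR (l * X i w))%:E = (expR (l ^+ 2 * K i i / 2))%:E)%E.
Proof.
apply: centered_gaussian_mgf; first exact: mX.
have vE : \sum_k \sum_j (k == i)%:R * (j == i)%:R * K k j = K i i.
  rewrite (bigD1 i)//= [X in _ + X]big1 ?addr0; last first.
    by move=> j /negbTE ji; rewrite big1// => k _; rewrite ji !mul0r.
  rewrite (bigD1 i)//= [X in _ + X]big1 ?addr0; last first.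
    by move=> j /negbTE ji; rewrite ji mulr0 mul0r.
  by rewrite eqxx !mul1r.
have sE : (fun w => \sum_k (k == i)%:R * X k w) = X i.
  apply/funext => w; rewrite (bigD1 i)//= big1 ?addr0 ?eqxx ?mul1r//.
  by move=> j /negbTE ji; rewrite ji mul0r.
by have := gX (fun j => (j == i)%:R); rewrite vE sE; exact.
Qed.

(** The mean of the sum of [expR (X i)]. It depends on the family, but only enters with a factor
    that tends to 0 as the rotation steps are refined. *)
Let C := \sum_i expR (K i i / 2).

Let mE i l : measurable_fun setT (fun w => expR (l * X i w)).
Proof. by apply: measurableT_comp => //; exact: measurable_funM. Qed.

Let mA j : measurable_fun setT (fun w => argmax kappa j (X ^~ w)).
Proof. exact: measurable_argmax. Qed.

Let AE0 j w (x : R) : 0 <= argmax kappa j (X ^~ w) * expR x.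
Proof. by apply: mulr_ge0; [exact: argmax_ge0|exact: expR_ge0]. Qed.

Let AEE0 j w (x y : R) : 0 <= argmax kappa j (X ^~ w) * expR x * expR y.
Proof. by apply: mulr_ge0; [exact: AE0|exact: expR_ge0]. Qed.

(** Once the first copy is fixed, only one index [j] remains, and integrating over the second copy
    gives the exponential moment of the single variable [X j], bounded through [Kv]. The factor with
    the small parameter [e] is linearized by [expR_convex0], and the indicators sum to 1. *)
Lemma integral_argmax_expR (e mu : R) : 0 <= e <= 1 ->
  (\int[P \x P]_p (\sum_j argmax kappa j (X ^~ p.1) * expR (e * X j p.1)
     * expR (mu * X j p.2))%:E <= (expR (mu ^+ 2 * v / 2) * (1 + e * C))%:E)%E.
Proof.
move=> /andP[e0 e1].
pose f (p : T * T) : R := \sum_j argmax kappa j (X ^~ p.1) * expR (e * X j p.1)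
     * expR (mu * X j p.2).
have f0 p : (0 <= (f p)%:E)%E.
  by rewrite lee_fin sumr_ge0// => j _; rewrite AEE0.
have mf : measurable_fun setT (EFin \o f).
  apply/measurable_EFinP; apply: measurable_sum => j; apply: measurable_funM.
    apply: measurable_funM; first exact: (measurableT_comp (mA j)).
    exact: (measurableT_comp (mE j e)).
  exact: (measurableT_comp (mE j mu)).
have -> := fubini_tonelli1 (m1 := P) (m2 := P) _ mf f0.
rewrite /fubini_F /=.
have inner w1 : (\int[P]_w2 (f (w1, w2))%:E =
    (\sum_j argmax kappa j (X ^~ w1) * expR (e * X j w1) * expR (mu ^+ 2 * K j j / 2))%:E)%E.
  rewrite /f /=; under eq_integral do rewrite -sumEFin.
  rewrite ge0_integral_sum//; last 2 first.
  - by move=> j; apply/measurable_EFinP; exact: measurable_funM.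
  - by move=> j w _; rewrite lee_fin AEE0.
  rewrite -sumEFin; apply: eq_bigr => j _.
  under eq_integral do rewrite EFinM.
  rewrite ge0_integralZl//; first by rewrite coordinate_mgf.
  - exact/measurable_EFinP.
  - by rewrite lee_fin AE0.
under eq_integral do rewrite inner.
pose g w : R := \sum_j 1 * expR (1 * X j w).
have gE : (\int[P]_w (g w)%:E = C%:E)%E.
  under eq_integral do rewrite -sumEFin.
  rewrite ge0_integral_sum//.
  - rewrite -sumEFin; apply: eq_bigr => j _; under eq_integral do rewrite mul1r.
    by rewrite coordinate_mgf expr1n mul1r.
  - by move=> j; apply/measurable_EFinP; exact: measurable_funM.
have g0 w : 0 <= g w by rewrite sumr_ge0// => j _; rewrite mul1r expR_ge0.
have mg : measurable_fun setT g.
  by apply: measurable_sum => j; exact: measurable_funM.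
have ev0 : 0 <= expR (mu ^+ 2 * v / 2) by exact: expR_ge0.
have oneE : (\int[P]_w (cst 1 w : R)%:E = 1%:E)%E.
  by rewrite /= integral_cst//= probability_setT mule1.
have hE := ge0_integral_comb (mu := P) (measurable_cst (1 : R)) mg (fun=> ler01) g0
  ev0 (mulr_ge0 ev0 e0) oneE gE.
rewrite (_ : expR (mu ^+ 2 * v / 2) * (1 + e * C) =
  expR (mu ^+ 2 * v / 2) * 1 + expR (mu ^+ 2 * v / 2) * e * C); last by ring.
rewrite -hE; apply: ge0_le_integral => //.
- by move=> w _; rewrite lee_fin sumr_ge0// => j _; rewrite AEE0.
- apply/measurable_EFinP; apply: measurable_sum => j; apply: measurable_funM => //.
  exact: measurable_funM.
- by apply/measurable_EFinP; apply: measurable_funD => //; exact: measurable_funM.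
move=> w _; rewrite lee_fin /=.
have -> : expR (mu ^+ 2 * v / 2) * 1 + expR (mu ^+ 2 * v / 2) * e * g w =
  expR (mu ^+ 2 * v / 2) * (1 + e * g w) by ring.
apply: (@le_trans _ _ (\sum_j expR (mu ^+ 2 * v / 2) * (argmax kappa j (X ^~ w) * (1 + e * g w)))).
  apply: ler_sum => j _; rewrite mulrC; apply: ler_pM.
  - exact: expR_ge0.
  - exact: AE0.
  - by rewrite ler_expR; have := Kv j; have := sqr_ge0 mu; nra.
  - apply: ler_wpM2l; first exact: argmax_ge0.
    apply: (@le_trans _ _ (1 + e * expR (X j w))); first by rewrite expR_convex0// e0.
    rewrite lerD2l ler_wpM2l// /g (bigD1 j)//= !mul1r lerDl sumr_ge0// => i _.
move: (1 + e * g w) => z.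
by rewrite -mulr_sumr -mulr_suml sum_argmax mul1r.
Qed.

Let mF1 : measurable_fun setT (fun p : T * T => F (X ^~ p.1)).
Proof.
apply: (measurable_affine_max kappa (Y := fun i (p : T * T) => X i p.1)) => i.
exact: (measurableT_comp (mX i)).
Qed.

Let mF2 : measurable_fun setT (fun p : T * T => F (X ^~ p.2)).
Proof.
apply: (measurable_affine_max kappa (Y := fun i (p : T * T) => X i p.2)) => i.
exact: (measurableT_comp (mX i)).
Qed.

(* F X - F Y telescopes along m + 1 rotations by the angle D = pi / 2 / (m + 1), which
   have the same law. For one rotation, from (x, y) to x' = cos D x - sin D y,
   F x - F x' <= x_j - x'_j where j is the maximizing index of F x. *)
Lemma integral_expR_affine_max_discrete (l : R) (m : nat) :
  0 <= l -> l * m.+1%:R * (1 - cos (pi / 2 / m.+1%:R)) <= 1 ->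
  (\int[P \x P]_p (expR (l * (F (X ^~ p.1) - F (X ^~ p.2))))%:E <=
   (expR ((l * m.+1%:R * sin (pi / 2 / m.+1%:R)) ^+ 2 * v / 2) *
     (1 + l * m.+1%:R * (1 - cos (pi / 2 / m.+1%:R)) * C))%:E)%E.
Proof.
move=> l0; set M := m.+1%:R; set D := pi / 2 / M => e1.
have M0 : 0 < M by [].
pose Z k (p : T * T) i := sin (k%:R * D) * X i p.1 + cos (k%:R * D) * X i p.2.
(* Rotating the tuple back by [D] turns [Z k.+1] into [Z k]. The factor [M] in the exponent is the
   price of Jensen's inequality over [M] increments. *)
pose G (t : (n.+1 + n.+1).-tuple R) : R := expR (l * M *
  (F (fun i => tnth t (lshift _ i)) -
   F (fun i => cos D * tnth t (lshift _ i) - sin D * tnth t (rshift _ i)))).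
have mG : measurable_fun setT G.
  apply: measurableT_comp => //; apply: measurable_funM => //.
  apply: measurable_funB; apply: measurable_affine_max => i.
    exact: measurable_tnth.
  by apply: measurable_funB; apply: measurable_funM => //; exact: measurable_tnth.
have mEG : measurable_fun setT (EFin \o G) by exact/measurable_EFinP.
have G0 t : (0 <= (EFin \o G) t)%E by rewrite lee_fin expR_ge0.
have ZG k p : expR (l * M * (F (Z k.+1 p) - F (Z k p))) =
    G (rotated X (sin (k.+1%:R * D)) (cos (k.+1%:R * D)) p).
  rewrite /G; have -> : (fun i => tnth (rotated X (sin (k.+1%:R * D)) (cos (k.+1%:R * D)) p)
      (lshift n.+1 i)) = Z k.+1 p.
    by apply/funext => i; rewrite rotated_lshift.
  have -> // : (fun i => cos D * tnth (rotated X (sin (k.+1%:R * D)) (cos (k.+1%:R * D)) p)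
      (lshift n.+1 i) - sin D * tnth (rotated X (sin (k.+1%:R * D)) (cos (k.+1%:R * D)) p)
      (rshift n.+1 i)) = Z k p.
  apply/funext => i; rewrite rotated_lshift rotated_rshift /Z.
  have -> : k%:R * D = k.+1%:R * D - D by rewrite -natr1; ring.
  by rewrite sinB cosB; ring.
have mZ k i : measurable_fun setT (Z k ^~ i).
  by apply: measurable_funD; apply: measurable_funM => //; exact: (measurableT_comp (mX i)).
have Z0 p : Z 0 p = X ^~ p.2.
  by apply/funext => i; rewrite /Z mul0r sin0 cos0 mul0r add0r mul1r.
have ZM p : Z m.+1 p = X ^~ p.1.
  have MD : M * D = pi / 2 by rewrite /D mulrC divfK// gt_eqF.
  apply/funext => i; rewrite /Z -/M MD.
  by rewrite sin_pihalf cos_pihalf mul1r mul0r addr0.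
have step p : expR (l * (F (X ^~ p.1) - F (X ^~ p.2))) <=
    M^-1 * \sum_(k < m.+1) G (rotated X (sin (k.+1%:R * D)) (cos (k.+1%:R * D)) p).
  have -> : l * (F (X ^~ p.1) - F (X ^~ p.2)) =
      \sum_(k < m.+1) l * (F (Z k.+1 p) - F (Z k p)).
    rewrite -mulr_sumr -(big_mkord xpredT (fun k => F (Z k.+1 p) - F (Z k p))).
    by rewrite telescope_sumr// ZM Z0.
  apply: (le_trans (expR_mean _)); apply: ler_wpM2l; first by rewrite invr_ge0 ltW.
  by apply: ler_sum => k _; rewrite -ZG mulrA [_ * l]mulrC.
have rotE k : (\int[P \x P]_p (G (rotated X (sin (k%:R * D)) (cos (k%:R * D)) p))%:E =
    \int[P \x P]_p (G (rotated X 1 0 p))%:E)%E.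
  apply: (ge0_integral_rotated mX gX _ mEG G0).
  by rewrite addrC cos2Dsin2.
have mGr s c : measurable_fun setT (fun p => G (rotated X s c p)).
  exact: (measurableT_comp mG (measurable_rotated mX s c)).
apply: (@le_trans _ _ (\int[P \x P]_p (G (rotated X 1 0 p))%:E)%E).
  apply: (@le_trans _ _ (\int[P \x P]_p (M^-1 * \sum_(k < m.+1) G (rotated X (sin (k.+1%:R * D)) (cos (k.+1%:R * D)) p))%:E)%E).
    apply: ge0_le_integral => //.
    - apply/measurable_EFinP.
      apply: (@measurableT_comp _ _ _ _ _ _ (@expR R) _ (fun p : T * T => l * (F (X ^~ p.1) - F (X ^~ p.2)))) => //.
      by apply: measurable_funM => //; exact: measurable_funB.
    - apply/measurable_EFinP; apply: measurable_funM => //.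
      by apply: measurable_sum => k.
    - by move=> p _; rewrite lee_fin.
  under eq_integral do rewrite EFinM -sumEFin.
  rewrite ge0_integralZl//; last 3 first.
  - by apply: emeasurable_sum => k; exact/measurable_EFinP.
  - by move=> p _; apply: sume_ge0 => k _; rewrite lee_fin expR_ge0.
  - by rewrite lee_fin invr_ge0 ltW.
  rewrite ge0_integral_sum//; last 2 first.
  - by move=> k; exact/measurable_EFinP.
  - by move=> k p _; rewrite lee_fin expR_ge0.
  rewrite (eq_bigr (fun=> \int[P \x P]_p (G (rotated X 1 0 p))%:E)%E); last first.
    by move=> k _; exact: rotE.
  have : (0 <= \int[P \x P]_p (G (rotated X 1 0 p))%:E)%E by apply: integral_ge0 => p _; exact: G0.
  case: (\int[_]_p _)%E => [c c0||//]; last by move=> _; rewrite leey.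
  rewrite sumEFin sumr_const card_ord -EFinM lee_fin -mulr_natl mulrA mulVf ?mul1r//.
  exact: lt0r_neq0.
have e0 : 0 <= l * M * (1 - cos D) <= 1.
  by rewrite e1 andbT mulr_ge0 ?subr_ge0 ?cos_le1// mulr_ge0// ltW.
(* The halves of [rotated X 1 0] are [X ^~ p.1] and [- X ^~ p.2]. At the maximizing index [j] the
   increment is at most [(1 - cos D) * X j p.1 - sin D * X j p.2], which dictates both
   parameters. *)
have := integral_argmax_expR (- (l * M * sin D)) e0; rewrite sqrrN.
apply: le_trans; apply: ge0_le_integral => //.
- by move=> p _; rewrite lee_fin expR_ge0.
- exact/measurable_EFinP.
- apply/measurable_EFinP; apply: measurable_sum => j; apply: measurable_funM.
    apply: measurable_funM; first exact: (measurableT_comp (mA j)).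
    exact: (measurableT_comp (mE j _)).
  exact: (measurableT_comp (mE j _)).
move=> p _; rewrite lee_fin.
have -> : G (rotated X 1 0 p) = expR (l * M * (F (X ^~ p.1) -
    F (fun i => cos D * X i p.1 - sin D * - X i p.2))).
  rewrite /G; have -> : (fun i => tnth (rotated X 1 0 p) (lshift n.+1 i)) = X ^~ p.1.
    by apply/funext => i; rewrite rotated_lshift; ring.
  have -> // : (fun i => cos D * tnth (rotated X 1 0 p) (lshift n.+1 i) -
      sin D * tnth (rotated X 1 0 p) (rshift n.+1 i)) =
    (fun i => cos D * X i p.1 - sin D * - X i p.2).
  by apply/funext => i; rewrite rotated_lshift rotated_rshift; ring.
rewrite -[leLHS]mul1r -[X in X * _ <= _](sum_argmax kappa (X ^~ p.1)) mulr_suml.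
apply: ler_sum => j _.
have [->|Aj] := eqVneq (argmax kappa j (X ^~ p.1)) 0; first by rewrite !mul0r.
rewrite -[leRHS]mulrA; apply: ler_wpM2l; first exact: argmax_ge0.
rewrite -expRD ler_expR /F (affine_max_argmax Aj).
have := affine_max_ge kappa (fun i => cos D * X i p.1 - sin D * - X i p.2) j.
set f2 := affine_max _ _ => h.
have lM : 0 <= l * M by rewrite mulr_ge0// ltW.
rewrite [leRHS](_ : _ = l * M * ((1 - cos D) * X j p.1 - sin D * X j p.2)); last by ring.
rewrite ler_wpM2l//; lra.
Qed.

(** For [D = pi / 2 / M] one has [M * sin D <= pi / 2], which gives the exponent, and
    [M * (1 - cos D) <= pi ^+ 2 / (8 * M)], so the correction with [C] vanishes as [M] grows. *)
Lemma maurey_pisier (l : R) : 0 <= v -> 0 <= l ->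
  (\int[P \x P]_p (expR (l * (F (X ^~ p.1) - F (X ^~ p.2))))%:E <=
   (expR (l ^+ 2 * pi ^+ 2 * v / 8))%:E)%E.
Proof.
move=> v0 l0; set E := expR _; have E0 : 0 <= E by exact: expR_ge0.
have C0 : 0 <= C by apply: sumr_ge0 => i _; exact: expR_ge0.
pose k : R := l * pi ^+ 2 / 8.
have k0 : 0 <= k by rewrite divr_ge0// mulr_ge0// sqr_ge0.
have bound m : k <= m.+1%:R ->
  (\int[P \x P]_p (expR (l * (F (X ^~ p.1) - F (X ^~ p.2))))%:E <=
   (E * (1 + k / m.+1%:R * C))%:E)%E.
  move=> km; have M0 : 0 < m.+1%:R :> R by [].
  have pi0 := pi_ge0 R.
  have D0 : 0 <= pi / 2 / m.+1%:R :> R by rewrite !divr_ge0.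
  have Dpi : pi / 2 / m.+1%:R <= pi :> R.
    rewrite -mulrA ler_piMr// -invfM invf_le1 ?mulr_gt0//.
    by rewrite -natrM ler1n muln_gt0.
  have h1 : l * m.+1%:R * (1 - cos (pi / 2 / m.+1%:R)) <= k / m.+1%:R.
    have -> : k / m.+1%:R = l * m.+1%:R * ((pi / 2 / m.+1%:R) ^+ 2 / 2).
      by rewrite /k; field; exact: lt0r_neq0.
    apply: ler_wpM2l; first by rewrite mulr_ge0// ltW.
    by apply: one_sub_cos_le; rewrite D0.
  have h2 : l * m.+1%:R * sin (pi / 2 / m.+1%:R) <= l * (pi / 2).
    have -> : l * (pi / 2) = l * m.+1%:R * (pi / 2 / m.+1%:R).
      by field; exact: lt0r_neq0.
    apply: ler_wpM2l; first by rewrite mulr_ge0// ltW.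
    exact: sin_le_id.
  have h3 : 0 <= l * m.+1%:R * sin (pi / 2 / m.+1%:R).
    by rewrite !mulr_ge0//; apply: sin_ge0_pi; rewrite D0.
  have km1 : k / m.+1%:R <= 1 by rewrite ler_pdivrMr// mul1r.
  apply: (le_trans (integral_expR_affine_max_discrete l0 (le_trans h1 km1))).
  rewrite lee_fin; apply: ler_pM.
  - exact: expR_ge0.
  - rewrite addr_ge0// mulr_ge0// mulr_ge0 ?subr_ge0 ?cos_le1// mulr_ge0//.
  - rewrite ler_expR (_ : l ^+ 2 * pi ^+ 2 * v / 8 = (l * (pi / 2)) ^+ 2 * v / 2); last by field.
    rewrite ler_pM2r// ler_wpM2r// lerXn2r// nnegrE.
    by rewrite mulr_ge0// divr_ge0.
  - by rewrite lerD2l ler_wpM2r.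
have fin : (\int[P \x P]_p (expR (l * (F (X ^~ p.1) - F (X ^~ p.2))))%:E)%E \is a fin_num.
  have [m km] : exists m, k <= m.+1%:R.
    exists (Num.bound k); have := archi_boundP k0 => /ltW /le_trans; apply.
    by rewrite ler_nat.
  rewrite ge0_fin_numE; first by rewrite (le_lt_trans (bound m km))// ltry.
  by apply: integral_ge0 => p _; rewrite lee_fin expR_ge0.
move: fin bound; case: (\int[_]_p _)%E => // r _ bound; rewrite lee_fin.
apply/ler_addgt0Pr => e e0.
(* For [M] above [A] both requirements hold: [k <= M], and the correction [E * (k * C) / M] is at
   most [e]. *)
pose A := k + E * (k * C) / e.
have q0 : 0 <= E * (k * C) / e.
  by apply: divr_ge0; [apply: mulr_ge0 => //; exact: mulr_ge0|exact: ltW].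
have A0 : 0 <= A by rewrite addr_ge0.
have Am : A < (Num.bound A).+1%:R.
  by rewrite (lt_le_trans (archi_boundP A0))// ler_nat.
have kA : k <= A by rewrite lerDl.
have := bound (Num.bound A) (le_trans kA (ltW Am)); rewrite lee_fin => /le_trans; apply.
rewrite mulrDr mulr1 lerD2l.
have M0 : 0 < (Num.bound A).+1%:R :> R by [].
have -> : E * (k / (Num.bound A).+1%:R * C) = E * (k * C) / (Num.bound A).+1%:R.
  by field; exact: lt0r_neq0.
by rewrite ler_pdivrMr// [e * _]mulrC -ler_pdivrMr// (le_trans _ (ltW Am))// lerDr.
Qed.

End maurey_pisier.

(** * Concentration of suprema of Gaussian families *)

Section exponential_moments.
Context d (T : measurableType d) (R : realType) (P : probability T R).
Implicit Types g : T -> R.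

Lemma expR_jensen0 g : measurable_fun setT g -> P.-integrable setT (EFin \o g) ->
  (\int[P]_w (g w)%:E = 0)%E -> (1 <= \int[P]_w (expR (g w))%:E)%E.
Proof.
move=> mg ig Eg.
have me : measurable_fun setT (fun w => (expR (g w))%:E).
  by apply/measurable_EFinP; exact: measurableT_comp.
have [->|fin] := eqVneq (\int[P]_w (expR (g w))%:E)%E +oo%E; first by rewrite leey.
have ie : P.-integrable setT (fun w => (expR (g w))%:E).
  apply/integrableP; split => //; rewrite ltey.
  by under eq_integral do rewrite gee0_abs ?lee_fin ?expR_ge0//.
have i1 : P.-integrable setT (fun w => (1 : R)%:E).
  exact: finite_measure_integrable_cst.
have -> : 1%E = (\int[P]_w ((1 : R)%:E + (g w)%:E))%E.
  by rewrite integralD//= Eg adde0 integral_cst//= probability_setT mule1.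
apply: le_integral => //; first exact: integrableD.
by move=> w _; rewrite -EFinD lee_fin expR_ge1Dx.
Qed.

Lemma expR_markov g (l u E : R) : measurable_fun setT g -> 0 <= l ->
  (\int[P]_w (expR (l * g w))%:E <= E%:E)%E ->
  (P [set w | (u < g w)%R] <= (expR (- (l * u)) * E)%:E)%E.
Proof.
move=> mg l0 Eg.
have mA : measurable [set w | (u < g w)%R].
  rewrite (_ : [set w | _] = setT `&` g @^-1` `]u, +oo[%classic); first exact: mg.
  by rewrite setTI; apply/seteqP; split => w /=; rewrite in_itv/= andbT.
have me : measurable_fun setT (fun w => (expR (l * g w))%:E).
  by apply/measurable_EFinP; apply: measurableT_comp => //; exact: measurable_funM.
have -> : P [set w | (u < g w)%R] = (\int[P]_w (\1_[set w | (u < g w)%R] w)%:E)%E.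
  by rewrite integral_indic// setIT.
apply: (@le_trans _ _ (\int[P]_w ((expR (- (l * u)))%:E * (expR (l * g w))%:E))%E).
  apply: ge0_le_integral => //.
  - exact/measurable_EFinP/measurable_indic.
  - by apply: emeasurable_funM.
  - move=> w _; rewrite -EFinM lee_fin -expRD indicE.
    case: (boolP (w \in _)) => [/set_mem /= uw|_]; last by rewrite expR_ge0.
    rewrite -[X in X <= _]expR0 ler_expR addrC -mulrBr mulr_ge0// subr_ge0.
    exact: ltW.
rewrite ge0_integralZl//.
by rewrite [leRHS]EFinM lee_wpmul2l ?lee_fin ?expR_ge0.
Qed.

End exponential_moments.

Section gaussian_concentration.
Context d (T : measurableType d) (R : realType) (P : probability T R) (n : nat).
Variables (X : 'I_n.+1 -> T -> R) (K : 'I_n.+1 -> 'I_n.+1 -> R) (v : R).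
Variable kappa : 'I_n.+1 -> R.
Hypothesis mX : forall i, measurable_fun setT (X i).
Hypothesis gX : forall a : 'I_n.+1 -> R,
  centered_gaussian P (\sum_i \sum_j a i * a j * K i j) (fun w => \sum_i a i * X i w).
Hypothesis Kv : forall i, K i i <= v.
Hypothesis v0 : 0 < v.

Let f w := affine_max kappa (X ^~ w).

Let mf : measurable_fun setT f.
Proof. exact: measurable_affine_max. Qed.

Lemma affine_max_integrable : P.-integrable setT (EFin \o f).
Proof.
have iE i l : P.-integrable setT (fun w => (expR (l * X i w))%:E).
  apply: (@ge0_integrable_fin _ _ _ P (fun w => expR (l * X i w)) (expR (l ^+ 2 * K i i / 2))).
  - by apply: measurableT_comp => //; exact: measurable_funM.
  - by move=> w; exact: expR_ge0.
  - exact: (coordinate_mgf mX gX).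
pose g w := (\sum_i ((expR (1 * X i w))%:E + (expR ((-1) * X i w))%:E + `|kappa i|%:E))%E.
have ig : P.-integrable setT g.
  apply: integrable_sum => // i _; apply: integrableD => //; first exact: integrableD.
  exact: finite_measure_integrable_cst.
apply: (le_integrable measurableT _ _ ig); first exact/measurable_EFinP.
move=> w _; rewrite /g /=.
under eq_bigr do rewrite -!EFinD.
rewrite sumEFin lee_fin [leRHS]ger0_norm; last first.
  by apply: sumr_ge0 => i _; rewrite !addr_ge0 ?expR_ge0.
rewrite /f; have [i ->] := affine_max_attained kappa (X ^~ w).
rewrite (bigD1 i)//= ler_wpDr//.
  by apply: sumr_ge0 => j _; rewrite !addr_ge0 ?expR_ge0.
rewrite (le_trans (ler_normB _ _))// lerD2r mul1r mulN1r.
have h1 := expR_ge1Dx (X i w); have h2 := expR_ge1Dx (- X i w).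
have h3 := expR_ge0 (X i w); have h4 := expR_ge0 (- X i w).
by rewrite ler_norml; apply/andP; split; lra.
Qed.

Let m : R := fine (\int[P]_w (f w)%:E)%E.

Let fE : (\int[P]_w (f w)%:E = m%:E)%E.
Proof. by rewrite fineK//; exact: integrable_fin_num affine_max_integrable. Qed.

Let centered_int l : P.-integrable setT (fun w => (l * (f w - m))%:E).
Proof.
under eq_fun do rewrite EFinM EFinB.
apply: integrableZl => //; apply: integrableB => //; first exact: affine_max_integrable.
exact: finite_measure_integrable_cst.
Qed.

Let centered_mean l : (\int[P]_w (l * (f w - m))%:E = 0)%E.
Proof.
under eq_integral do rewrite EFinM EFinB.
have im : P.-integrable setT (fun w => m%:E) by exact: finite_measure_integrable_cst.
rewrite integralZl//; last first.
  by apply: integrableB => //; exact: affine_max_integrable.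
rewrite integralB//; last exact: affine_max_integrable.
by rewrite fE integral_cst//= probability_setT mule1 subee// mule0.
Qed.

Let mfl l : measurable_fun setT (fun w => l * (f w - m)).
Proof. by apply: measurable_funM => //; exact: measurable_funB. Qed.

(* E exp (l (F X - F Y)) is the product of the two integrals, which are both at
   least 1 by Jensen's inequality. *)
Lemma affine_max_mgf l : 0 <= l ->
  (\int[P]_w (expR (l * (f w - m)))%:E <= (expR (l ^+ 2 * pi ^+ 2 * v / 8))%:E)%E /\
  (\int[P]_w (expR (l * (m - f w)))%:E <= (expR (l ^+ 2 * pi ^+ 2 * v / 8))%:E)%E.
Proof.
move=> l0.
have mp := maurey_pisier kappa mX gX Kv (ltW v0) l0.
set E := (expR _)%:E in mp *.
have ma l' : measurable_fun setT (fun w => (expR (l' * (f w - m)))%:E).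
  by apply/measurable_EFinP; exact: measurableT_comp.
have A1 := expR_jensen0 (mfl l) (centered_int l) (centered_mean l).
have B1 := expR_jensen0 (mfl (- l)) (centered_int (- l)) (centered_mean (- l)).
set A := (\int[P]_w (expR (l * (f w - m)))%:E)%E in A1 *.
set B := (\int[P]_w (expR (- l * (f w - m)))%:E)%E in B1.
have -> : (\int[P]_w (expR (l * (m - f w)))%:E)%E = B.
  by apply: eq_integral => w _; congr (expR _)%:E; ring.
suff AB : (A * B <= E)%E.
  have A0 : (0 <= A)%E by apply: le_trans A1; rewrite lee_fin.
  have B0 : (0 <= B)%E by apply: le_trans B1; rewrite lee_fin.
  split; apply: le_trans AB.
    by rewrite -[leLHS]mule1 lee_wpmul2l.
  by rewrite -[leLHS]mul1e lee_wpmul2r.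
apply: le_trans mp.
have mef : measurable_fun setT (fun p : T * T => (expR (l * (f p.1 - f p.2)))%:E).
  apply/measurable_EFinP; apply: measurableT_comp => //; apply: measurable_funM => //.
  by apply: measurable_funB; exact: (measurableT_comp mf).
have ef0 (p : T * T) : (0 <= (expR (l * (f p.1 - f p.2)))%:E)%E by rewrite lee_fin expR_ge0.
have := fubini_tonelli1 (m1 := P) (m2 := P) _ mef ef0 => ->.
rewrite /fubini_F /A -ge0_integralZr//; last by apply: le_trans B1; rewrite lee_fin.
rewrite le_eqVlt; apply/orP; left; apply/eqP; apply: eq_integral => w _ /=.
rewrite /B -ge0_integralZl//.
by apply: eq_integral => w' _; rewrite -EFinM -expRD; congr (expR _)%:E; ring.
Qed.

Lemma affine_max_deviation u : 0 < u ->
  (P [set w | (u < `|f w - m|)%R] <= (2 * expR (- (2 / pi ^+ 2 * u ^+ 2 / v)))%:E)%E.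
Proof.
move=> u0; have p0 := pi_gt0 R.
(* The minimizer of [- (l * u) + l ^+ 2 * pi ^+ 2 * v / 8]; the minimum is
   [- (2 / pi ^+ 2 * u ^+ 2 / v)]. The factor 2 in the bound counts the two tails. *)
pose l := 4 * u / (pi ^+ 2 * v).
have l0 : 0 <= l by rewrite divr_ge0 ?mulr_ge0 ?sqr_ge0// ltW.
have [h1 h2] := affine_max_mgf l0.
have lE : expR (- (l * u)) * expR (l ^+ 2 * pi ^+ 2 * v / 8) =
    expR (- (2 / pi ^+ 2 * u ^+ 2 / v)).
  rewrite -expRD; congr expR; rewrite /l; move: (pi : R) p0 => p p0.
  by field; rewrite !lt0r_neq0.
have mfm : measurable_fun setT (fun w => f w - m) by exact: measurable_funB.
have mmf : measurable_fun setT (fun w => m - f w) by exact: measurable_funB.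
have t1 := expR_markov u mfm l0 h1; have t2 := expR_markov u mmf l0 h2.
rewrite lE in t1 t2.
have mgt g : measurable_fun setT g -> measurable [set w : T | (u < g w)%R].
  move=> mg; rewrite (_ : [set w | _] = setT `&` g @^-1` `]u, +oo[%classic); first exact: mg.
  by rewrite setTI; apply/seteqP; split => w /=; rewrite in_itv/= andbT.
have -> : [set w | (u < `|f w - m|)%R] =
    [set w | (u < f w - m)%R] `|` [set w | (u < m - f w)%R].
  apply/seteqP; split => w /=; rewrite ltr_normr opprB.
    by move=> /orP[h|h]; [left|right].
  by move=> [->|->]//; rewrite orbT.
apply: (le_trans (measureU2 _ _ _)); [exact: mgt|exact: mgt|].
by rewrite mulrDl mul1r EFinD leeD.
Qed.

End gaussian_concentration.

Section countable_supremum.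
Context d (T : measurableType d) (R : realType) (P : probability T R).
Variables (xi : nat -> T -> R) (kappa : nat -> R) (K : nat -> nat -> R) (v : R).
Hypothesis mxi : forall k, measurable_fun setT (xi k).
Hypothesis gxi : forall n (a : 'I_n -> R),
  centered_gaussian P (\sum_i \sum_j a i * a j * K i j) (fun w => \sum_i a i * xi i w).
Hypothesis Kv : forall k, K k k <= v.
Hypothesis v0 : 0 < v.
Hypothesis xi0 : forall w, xi 0 w = kappa 0.

(** Increasing in [n] to the supremum, and nonnegative by [xi0], so that monotone convergence
    applies to the means. *)
Let F n w := affine_max (fun i : 'I_n.+1 => kappa i) (fun i => xi i w).

Definition affine_sup w : \bar R := ereal_sup (range (fun k => (xi k w - kappa k)%:E)).

Let F_ge n k w : (k <= n)%N -> xi k w - kappa k <= F n w.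
Proof.
rewrite -ltnS => kn.
exact: (affine_max_ge (fun i : 'I_n.+1 => kappa i) (fun i => xi i w) (Ordinal kn)).
Qed.

Let F_attained n w : exists2 k, (k <= n)%N & F n w = xi k w - kappa k.
Proof.
have [i iE] := affine_max_attained (fun i : 'I_n.+1 => kappa i) (fun i => xi i w).
by exists i => //; rewrite -ltnS.
Qed.

Let F_nd w m n : (m <= n)%N -> F m w <= F n w.
Proof.
by move=> mn; have [k km ->] := F_attained m w; apply: F_ge; exact: leq_trans mn.
Qed.

Let F_ge0 n w : 0 <= F n w.
Proof. by have := F_ge w (leq0n n); rewrite xi0 subrr. Qed.

Let F_le_sup n w : ((F n w)%:E <= affine_sup w)%E.
Proof.
by have [k _ ->] := F_attained n w; apply: ereal_sup_ubound; exists k.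
Qed.

Let F_cvg w : (F n w)%:E @[n --> \oo] --> affine_sup w.
Proof.
have -> : affine_sup w = ereal_sup (range (fun n => (F n w)%:E)).
  apply/eqP; rewrite eq_le; apply/andP; split; apply: ge_ereal_sup => _ [n _ <-].
    apply: (@le_trans _ _ (F n w)%:E); first by rewrite lee_fin F_ge.
    by apply: ereal_sup_ubound; exists n.
  exact: F_le_sup.
by apply: ereal_nondecreasing_cvgn => m n mn; rewrite lee_fin F_nd.
Qed.

Let mF n : measurable_fun setT (F n).
Proof. exact: (measurable_affine_max (fun i : 'I_n.+1 => kappa i) (fun i : 'I_n.+1 => mxi i)). Qed.

Lemma measurable_affine_sup : measurable_fun setT affine_sup.
Proof.
apply: (emeasurable_fun_cvg (fun n w => (F n w)%:E)) => [n|w _].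
  exact/measurable_EFinP.
exact: F_cvg.
Qed.

Lemma affine_sup_ge0 w : (0 <= affine_sup w)%E.
Proof. by apply: (le_trans _ (F_le_sup 0 w)); rewrite lee_fin. Qed.

Let E n : R := fine (\int[P]_w (F n w)%:E)%E.

Let EE n : (\int[P]_w (F n w)%:E = (E n)%:E)%E.
Proof.
rewrite fineK//; apply: integrable_fin_num => //.
exact: (affine_max_integrable (fun i : 'I_n.+1 => kappa i)
  (fun i : 'I_n.+1 => mxi i) (@gxi n.+1)).
Qed.

Let F_deviation n u : 0 < u ->
  (P [set w | (u < `|F n w - E n|)%R] <= (2 * expR (- (2 / pi ^+ 2 * u ^+ 2 / v)))%:E)%E.
Proof.
exact: (affine_max_deviation (fun i : 'I_n.+1 => kappa i)
  (fun i : 'I_n.+1 => mxi i) (@gxi n.+1) (fun i => Kv i) v0).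
Qed.

Let measurable_gt (u c : R) n : measurable [set w | (u < `|F n w - c|)%R].
Proof.
have mg : measurable_fun setT (fun w => `|F n w - c|).
  by apply: measurableT_comp => //; exact: measurable_funB.
rewrite (_ : [set w | _] = setT `&` (fun w => `|F n w - c|) @^-1` `]u, +oo[%classic); first exact: mg.
by rewrite setTI; apply/seteqP; split => w /=; rewrite in_itv/= andbT.
Qed.

Hypothesis sup_fin : {ae P, forall w, (affine_sup w < +oo)%E}.

Let measurable_sup_lt : measurable [set w | (affine_sup w < +oo)%E].
Proof.
rewrite (_ : [set w | _] = setT `&` affine_sup @^-1` [set` Interval -oo%O (BLeft +oo%E)]).
  by apply: measurable_affine_sup => //; exact: emeasurable_itv.
by rewrite setTI; apply/seteqP; split => w /=; rewrite in_itv.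
Qed.

Let prob_sup_lt : P [set w | (affine_sup w < +oo)%E] = 1%E.
Proof.
rewrite -[X in P X]setCK probability_setC; last exact: measurableC.
rewrite measure_negligible ?sube0//; first exact: measurableC.
Qed.

(* Unbounded means would give, by concentration, P (affine_sup <= k) <= 1 / 2 for
   every k. *)
Let E_bounded : exists M, forall n, E n <= M.
Proof.
(* Since [(1 + a) ^+ 2 >= a] for [a = 3 * pi ^+ 2 * v / 2], the exponent in the deviation bound is
   at least 3, and [expR 3 >= 4] brings the bound below one half. *)
pose u := 1 + 3 * pi ^+ 2 * v / 2.
have p0 := pi_gt0 R.
have c0 : 0 < 3 * pi ^+ 2 * v / 2 by rewrite divr_gt0// mulr_gt0// mulr_gt0// exprn_gt0.
have u0 : 0 < u by rewrite addr_gt0.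
have q2 : 2 * expR (- (2 / pi ^+ 2 * u ^+ 2 / v)) <= 2^-1.
  have h : 3 <= 2 / pi ^+ 2 * u ^+ 2 / v.
    have -> : 3 = 2 / pi ^+ 2 * (3 * pi ^+ 2 * v / 2) / v.
      by move: (pi : R) p0 => p p0; field; rewrite !lt0r_neq0.
    rewrite ler_pM2r ?invr_gt0// ler_wpM2l ?divr_ge0 ?sqr_ge0//.
    by rewrite /u; nra.
  have h1 : expR (- (2 / pi ^+ 2 * u ^+ 2 / v)) <= expR (- 3) by rewrite ler_expR lerN2.
  have h2 : expR (- 3 : R) <= 4^-1.
    rewrite expRN lef_pV2 ?posrE ?expR_gt0//.
    by have := @expR_ge1Dx R 3; lra.
  lra.
apply: contrapT => /forallNP unb.
pose A k := [set w | (affine_sup w <= k%:R%:E)%E].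
have mA k : measurable (A k).
  rewrite (_ : A k = setT `&` affine_sup @^-1` `]-oo, k%:R%:E]%classic).
    by apply: measurable_affine_sup => //; exact: emeasurable_itv.
  by rewrite setTI; apply/seteqP; split => w /=; rewrite in_itv.
have A_half k : (P (A k) <= (2^-1)%:E)%E.
  have [n] : exists n, k%:R + u < E n.
    have /existsNP[n /negP] := unb (k%:R + u); rewrite -ltNge => h; by exists n.
  move=> hn; apply: le_trans (_ : (2 * expR (- (2 / pi ^+ 2 * u ^+ 2 / v)))%:E <= _)%E; last by rewrite lee_fin.
  apply: le_trans (F_deviation n u0).
  apply: le_measure; rewrite ?inE//.
  move=> w /= wk; have := le_trans (F_le_sup n w) wk; rewrite lee_fin => Fk.
  by rewrite ltr_normr opprB; apply/orP; right; lra.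
have A_nd : nondecreasing_seq A.
  move=> i j ij; apply/subsetPset => w /= /le_trans; apply.
  by rewrite lee_fin ler_nat.
have cvgA := nondecreasing_cvg_mu (mu := P) mA (bigcupT_measurable _ mA) A_nd.
have UA : \bigcup_k A k = [set w | (affine_sup w < +oo)%E].
  apply/seteqP; split => w /=.
    by move=> [k _] /= /le_lt_trans; apply; rewrite ltry.
  move=> wfin; have wf : affine_sup w \is a fin_num by rewrite ge0_fin_numE// affine_sup_ge0.
  exists (Num.bound (fine (affine_sup w))) => //=.
  rewrite /A /= -[leLHS](fineK wf) lee_fin ltW// archi_boundP//.
  by rewrite fine_ge0// affine_sup_ge0.
have : (P (\bigcup_k A k) <= (2^-1)%:E)%E.
  rewrite -(cvg_lim _ cvgA)//; apply: lime_le; first by apply/cvg_ex; eexists; exact: cvgA.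
  by apply: nearW => k; exact: A_half.
by rewrite UA prob_sup_lt lee_fin; lra.
Qed.

Let E_cvg : (E n)%:E @[n --> \oo] --> (\int[P]_w affine_sup w)%E.
Proof.
under eq_fun do rewrite -EE.
have -> : (\int[P]_w affine_sup w = \int[P]_w limn (fun n => (F n w)%:E))%E.
  by apply: eq_integral => w _; apply/esym/cvg_lim.
apply: cvg_monotone_convergence => //.
- by move=> n; exact/measurable_EFinP.
- by move=> n w _; rewrite lee_fin.
- by move=> w _ m n mn; rewrite lee_fin F_nd.
Qed.

Lemma affine_sup_integral_fin : (\int[P]_w affine_sup w)%E \is a fin_num.
Proof.
rewrite ge0_fin_numE; last by apply: integral_ge0 => w _; exact: affine_sup_ge0.
have [M EM] := E_bounded.
rewrite -(cvg_lim _ E_cvg)//; apply: (@le_lt_trans _ _ M%:E); last exact: ltry.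
apply: lime_le; first by apply/cvg_ex; eexists; exact: E_cvg.
by apply: nearW => n; rewrite lee_fin.
Qed.

(** The strict inequality is an open condition: where the supremum deviates by more than [u], so
    does [F n] from [E n] for all large [n]. The event lies in the increasing union of the [B m],
    each of which inherits the bound for [F m]. *)
Lemma affine_sup_deviation u : 0 < u ->
  (P [set w | (affine_sup w < +oo)%E /\
      (u%:E < `|affine_sup w - \int[P]_w' affine_sup w'|)%E] <=
   (2 * expR (- (2 / pi ^+ 2 * u ^+ 2 / v)))%:E)%E.
Proof.
move=> u0; have If := affine_sup_integral_fin.
set I := (\int[P]_w' affine_sup w')%E in If *.
set q := (2 * _)%:E.
have EI : E n @[n --> \oo] --> fine I.
  have h : (E n)%:E @[n --> \oo] --> (fine I)%:E by rewrite fineK//; exact: E_cvg.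
  exact: (fine_cvg h).
pose B m := \bigcap_(n >= m) [set w | (u < `|F n w - E n|)%R].
have mB m : measurable (B m) by apply: bigcap_measurable; [exists m => /=|move=> k _; exact: measurable_gt].
have B_nd : nondecreasing_seq B.
  move=> i j ij; apply/subsetPset => w /= h k /= jk; apply: h => /=.
  exact: leq_trans jk.
have PB m : (P (B m) <= q)%E.
  apply: le_trans (F_deviation m u0); apply: le_measure.
  - by rewrite inE; exact: mB.
  - by rewrite inE; exact: measurable_gt.
  - by move=> w /(_ m); apply => /=.
have cvgPB := nondecreasing_cvg_mu (mu := P) mB (bigcupT_measurable _ mB) B_nd.
have : (P (\bigcup_k B k) <= q)%E.
  rewrite -(cvg_lim _ cvgPB)//; apply: lime_le; first by apply/cvg_ex; eexists; exact: cvgPB.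
  by apply: nearW => k; exact: PB.
apply: le_trans; apply: le_measure; last first.
- move=> w [/= wfin wu].
  have wf : affine_sup w \is a fin_num by rewrite ge0_fin_numE// affine_sup_ge0.
  have Fw : F n w @[n --> \oo] --> fine (affine_sup w).
    have h : (F n w)%:E @[n --> \oo] --> (fine (affine_sup w))%:E by rewrite fineK//; exact: F_cvg.
    exact: (fine_cvg h).
  have FE : `|F n w - E n| @[n --> \oo] --> `|fine (affine_sup w) - fine I|.
    by apply: cvg_norm; exact: cvgB.
  move: wu; rewrite -(fineK wf) -(fineK If) -EFinB abse_EFin lte_fin => wu.
  have [m _ mP] : \forall n \near \oo, u < `|F n w - E n|.
    exact: (cvgr_gt _ FE).
  by exists m => // n /= mn; exact: mP.
- by rewrite inE; exact: bigcupT_measurable.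
- rewrite inE.
  have mD : measurable_fun setT (fun w => `|affine_sup w - I|%E).
    apply: measurableT_comp => //; apply: emeasurable_funB => //.
    exact: measurable_affine_sup.
  have mS : measurable [set w | (u%:E < `|affine_sup w - I|)%E].
    rewrite (_ : [set w | _] = setT `&` (fun w => `|affine_sup w - I|%E) @^-1` `]u%:E, +oo[%classic).
      by apply: mD => //; exact: emeasurable_itv.
    by rewrite setTI; apply/seteqP; split => w /=; rewrite in_itv/= andbT.
  exact: (measurableI _ _ measurable_sup_lt mS).
Qed.

End countable_supremum.

(** * Almost everywhere equality with a measurable function *)

Section ae_equal.
Context d (T : measurableType d) (R : realType) (P : probability T R).

Import HBNNSimple.

(** Read off the integral as a supremum over simple functions below the integrand, which makes sense
    without measurability. *)
Lemma le_nnintegral (f g : T -> \bar R) : (forall w, 0 <= f w)%E ->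
  (forall w, 0 <= g w)%E -> (forall w, f w <= g w)%E ->
  (\int[P]_w f w <= \int[P]_w g w)%E.
Proof.
move=> f0 g0 fg; rewrite !ge0_integralTE//; apply: le_ereal_sup => _ [h hf <-].
by exists h => // x; apply: le_trans (fg x); exact: hf.
Qed.

(* [f] need not be measurable, as [P] need not be complete. *)
Lemma ge0_integral_ae_eq (f g : T -> \bar R) : (forall w, 0 <= f w)%E ->
  (forall w, 0 <= g w)%E -> measurable_fun setT g ->
  {ae P, forall w, f w = g w} -> (\int[P]_w f w = \int[P]_w g w)%E.
Proof.
move=> f0 g0 mg [N [mN PN0 fgN]].
have fgE w : ~ N w -> f w = g w.
  by move=> Nw; apply: contrapT => fg; apply: Nw; exact: fgN.
apply/eqP; rewrite eq_le; apply/andP; split.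
  rewrite ge0_integralTE//; apply: ge_ereal_sup => _ [h hf <-].
  rewrite -integralT_nnsfun; apply: ae_ge0_le_integral => //.
  - by move=> w _; rewrite lee_fin.
  - exact/measurable_EFinP.
  - exists N; split => // w /= h1; apply: contrapT => Nw; apply: h1 => _.
    by rewrite -(fgE w Nw); exact: hf.
(* Cut off on the null set [N], the function [g] keeps its integral and lies below [f]
   everywhere. *)
apply: (@le_trans _ _ (\int[P]_w (g \_ (~` N)) w)%E).
  apply: ae_ge0_le_integral => //.
  - by move=> w _; rewrite patchE; case: ifP.
  - apply: (proj1 (measurable_restrictT _ _)); first exact: measurableC.
    exact: measurable_funTS.
  - exists N; split => // w /= h1; apply: contrapT => Nw; apply: h1 => _.
    by rewrite patchE mem_set.
apply: le_nnintegral => // [w|w]; rewrite patchE; case: ifP => // /set_mem Nw.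
by rewrite fgE.
Qed.

(** The deviation event of [f] may fail to be measurable, but it is covered by the measurable event
    for [g] and two null sets, and the outer measure is monotone. *)
Lemma deviation_prob_ae_le (f g : T -> \bar R) (u : R) (q : \bar R) :
  (forall w, 0 <= f w)%E -> (forall w, 0 <= g w)%E -> measurable_fun setT g ->
  {ae P, forall w, f w = g w} -> {ae P, forall w, (g w < +oo)%E} ->
  (\int[P]_w g w)%E \is a fin_num ->
  (P [set w | (g w < +oo)%E /\ (u%:E < `|g w - \int[P]_w' g w'|)%E] <= q)%E ->
  (deviation_prob P f u <= q)%E.
Proof.
move=> f0 g0 mg fg gfin Ig Pq.
rewrite /deviation_prob (ge0_integral_ae_eq f0 g0 mg fg).
move: fg gfin => [N1 [mN1 PN1 fgN1]] [N2 [mN2 PN2 gN2]].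
set A := [set w | _] in Pq.
have mA : measurable A.
  have m1 : measurable [set w | (g w < +oo)%E].
    rewrite (_ : [set w | _] = setT `&` g @^-1` [set` Interval -oo%O (BLeft +oo%E)]).
      by apply: mg => //; exact: emeasurable_itv.
    by rewrite setTI; apply/seteqP; split => w /=; rewrite in_itv.
  have mD : measurable_fun setT (fun w => `|g w - \int[P]_w' g w'|%E).
    by apply: measurableT_comp => //; exact: emeasurable_funB.
  have m2 : measurable [set w | (u%:E < `|g w - \int[P]_w' g w'|)%E].
    rewrite (_ : [set w | _] = setT `&` (fun w => `|g w - \int[P]_w' g w'|%E) @^-1` `]u%:E, +oo[%classic).
      by apply: mD => //; exact: emeasurable_itv.
    by rewrite setTI; apply/seteqP; split => w /=; rewrite in_itv/= andbT.
  exact: (measurableI _ _ m1 m2).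
pose B := A `|` (N1 `|` N2).
have mN : measurable (N1 `|` N2) by exact: measurableU.
have mB : measurable B by exact: measurableU.
apply: (@le_trans _ _ (mu_ext P B)).
  apply: le_mu_ext => w /= uw.
  have [Nw|Nw] := pselect ((N1 `|` N2) w); [by right|left].
  split.
    by apply: contrapT => h; apply: Nw; right; exact: gN2.
  suff <- : f w = g w by [].
  by apply: contrapT => h; apply: Nw; left; exact: fgN1.
rewrite measurable_mu_extE//.
apply: (le_trans (measureU2 _ mA mN)).
have PN : (P (N1 `|` N2) <= 0)%E.
  apply: (le_trans (measureU2 _ mN1 mN2)).
  by rewrite [X in (X + _)%E]PN1 [X in (_ + X)%E]PN2 adde0.
by apply: (le_trans (leeD Pq PN)); rewrite adde0.
Qed.

End ae_equal.

Lemma gaussian_sup_deviation d (T : measurableType d) (R : realType)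
  (P : probability T R) (xi : nat -> T -> R) (kappa : nat -> R)
  (K : nat -> nat -> R) (v : R) (X : T -> \bar R) (u : R) :
  (forall k, measurable_fun setT (xi k)) ->
  (forall n (a : 'I_n -> R), centered_gaussian P
     (\sum_i \sum_j a i * a j * K i j) (fun w => \sum_i a i * xi i w)) ->
  (forall k, K k k <= v) -> 0 < v -> (forall w, xi 0 w = kappa 0) ->
  (forall w, 0 <= X w)%E ->
  {ae P, forall w, X w = affine_sup xi kappa w /\ (X w < +oo)%E} ->
  0 < u ->
  (deviation_prob P X u <= (2 * expR (- (2 / pi ^+ 2 * u ^+ 2 / v)))%:E)%E.
Proof.
move=> mxi gxi Kv v0 xi0 X0 Xae u0.
have sup_fin : {ae P, forall w, (affine_sup xi kappa w < +oo)%E}.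
  by apply: filterS Xae => w [<-].
have Xeq : {ae P, forall w, X w = affine_sup xi kappa w}.
  by apply: filterS Xae => w [].
have G0 := affine_sup_ge0 xi0.
have mG := measurable_affine_sup kappa mxi.
have IG := affine_sup_integral_fin mxi gxi Kv v0 xi0 sup_fin.
apply: (deviation_prob_ae_le X0 G0 mG Xeq sup_fin IG).
exact: (affine_sup_deviation mxi gxi Kv v0 xi0 sup_fin u0).
Qed.

(** * Increments of fractional Brownian motion *)

Section power_increments.
Context (R : realType) (p : R).
Hypothesis p1 : 1 <= p.
Implicit Types x h k a b c e : R.

Let p_gt0 : 0 < p. Proof. exact: lt_le_trans p1. Qed.

(** Both [x + h] and [x + k] are convex combinations of [x] and [x + h + k], with complementary
    weights; the two convexity inequalities add up. *)
Lemma powR_superadditive_increment x h k : 0 <= x -> 0 <= h -> 0 <= k ->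
  (x + h) `^ p + (x + k) `^ p <= x `^ p + (x + h + k) `^ p.
Proof.
move=> x0 h0 k0.
have [hk0|hk_neq0] := eqVneq (h + k) 0.
  move/eqP: hk0; rewrite paddr_eq0// => /andP[/eqP -> /eqP ->].
  by rewrite !addr0.
have hk : 0 < h + k by rewrite lt0r hk_neq0 addr_ge0.
have conv_le (t y z : R) : 0 <= t <= 1 -> 0 <= y -> 0 <= z ->
    (t * y + (1 - t) * z) `^ p <= t * y `^ p + (1 - t) * z `^ p.
  move=> /andP[t0 t1] y0 z0.
  by have := convex_powR p1 (Itv01 t0 t1) (x := y) (y := z); apply; rewrite inE/= in_itv/= andbT.
pose t := k / (h + k).
have t01 : 0 <= t <= 1.
  by apply/andP; split; [exact: (divr_ge0 k0 (ltW hk))|rewrite ler_pdivrMr// mul1r lerDr].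
have t01' : 0 <= 1 - t <= 1 by move: t01 => /andP[t0 t1]; apply/andP; split; lra.
have xhk : 0 <= x + h + k by rewrite !addr_ge0.
have E1 := conv_le t x (x + h + k) t01 x0 xhk.
have E2 := conv_le (1 - t) x (x + h + k) t01' x0 xhk.
have e1 : t * x + (1 - t) * (x + h + k) = x + h by rewrite /t; field.
have e2 : (1 - t) * x + (1 - (1 - t)) * (x + h + k) = x + k by rewrite /t; field.
rewrite e1 in E1; rewrite e2 in E2; lra.
Qed.

(* Covariance of the increments over [a, b] and [c, e] of a fractional Brownian
   motion with Hurst index p / 2. *)
Definition increment_cov a b c e : R :=
  2^-1 * (`|e - a| `^ p + `|c - b| `^ p - `|e - b| `^ p - `|c - a| `^ p).

(** The previous inequality with the gap [c - b] as base point and the two lengths as increments.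
    This is what [H >= 1/2] is for, through [p = 2H >= 1]. *)
Lemma increment_cov_ge0 a b c e : a <= b -> b <= c -> c <= e ->
  0 <= increment_cov a b c e.
Proof.
move=> ab bc ce; rewrite mulr_ge0 ?invr_ge0//.
have h := @powR_superadditive_increment (c - b) (e - c) (b - a).
rewrite !ger0_norm; [|lra..].
have -> : e - a = c - b + (e - c) + (b - a) by ring.
have -> : e - b = c - b + (e - c) by ring.
have -> : c - a = c - b + (b - a) by ring.
by have := h ltac:(lra) ltac:(lra) ltac:(lra); lra.
Qed.

Lemma increment_covC a b c e : increment_cov a b c e = increment_cov c e a b.
Proof. by rewrite /increment_cov (distrC b c) (distrC a c) (distrC b e) (distrC a e); ring. Qed.

Lemma increment_cov_catl a b c e f : increment_cov a b e f + increment_cov b c e f =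
  increment_cov a c e f.
Proof. by rewrite /increment_cov; ring. Qed.

Lemma increment_cov_diag a b : a <= b -> increment_cov a b a b = (b - a) `^ p.
Proof.
move=> ab; rewrite /increment_cov !subrr normr0 powR0 ?gt_eqF// (distrC a b).
by rewrite ger0_norm ?subr_ge0//; field.
Qed.

End power_increments.

(** * Variance of a sum of increments over interlaced intervals *)

Section interlaced_covariance.
Context (R : realType) (p s t : R) (n : nat) (a b : nat -> R).
Hypothesis p1 : 1 <= p.
Hypothesis ab : interlaced s t n a b.

Let alt i : (i < n)%N -> a i < b i. Proof. by case: ab => _ h _ _; exact: h. Qed.
Let blt i : (i.+1 < n)%N -> b i < a i.+1. Proof. by case: ab => _ _ h _; exact: h. Qed.

Lemma interlaced_le i j : (i < j)%N -> (j < n)%N -> b i <= a j.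
Proof.
elim: j => // j ih; rewrite ltnS leq_eqVlt => /predU1P[->|ij] jn.
  exact/ltW/blt.
apply: (le_trans (ih ij (ltnW jn))); apply: ltW; apply: (lt_trans (alt (ltnW jn))).
exact: blt.
Qed.

Lemma interlaced_ge i : (i < n)%N -> s <= a i.
Proof.
case: ab => sa _ _ _; case: i => // i iN; apply: (le_trans sa).
apply: (le_trans (ltW (alt (leq_ltn_trans (leq0n _) iN)))).
exact: interlaced_le.
Qed.

Lemma interlaced_le_end i : (i < n)%N -> b i <= t.
Proof.
case: ab => _ _ _ bt iN; apply: le_trans bt.
have [->|ni] := eqVneq i n.-1 => //.
have n0 : (0 < n)%N by apply: leq_ltn_trans iN.
have lti : (i < n.-1)%N by rewrite ltn_neqAle ni -ltnS prednK.
apply: (le_trans (interlaced_le lti _)); first by rewrite prednK.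
by apply/ltW/alt; rewrite prednK.
Qed.

Let cov i j := increment_cov p (a i) (b i) (a j) (b j).

Let cov_ge0 i j : (i < n)%N -> (j < n)%N -> 0 <= cov i j.
Proof.
move=> iN jN; rewrite /cov; have [ij|ji|->] := ltngtP i j.
- by apply: increment_cov_ge0 => //; [exact/ltW/alt|exact: interlaced_le|exact/ltW/alt].
- rewrite increment_covC.
  by apply: increment_cov_ge0 => //; [exact/ltW/alt|exact: interlaced_le|exact/ltW/alt].
- by rewrite increment_cov_diag ?powR_ge0//; exact/ltW/alt.
Qed.

(* The gaps between the intervals [a i, b i] contribute nonnegatively. *)
Lemma interlaced_cov_last k : (0 < k)%N -> (k < n)%N ->
  \sum_(i < k) cov i k <= increment_cov p (a 0%N) (a k) (a k) (b k).
Proof.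
move=> k0 kn.
have key j : (j < k)%N -> \sum_(i < j.+1) cov i k <= increment_cov p (a 0%N) (b j) (a k) (b k).
  elim: j => [|j ih] jk; first by rewrite big_ord1.
  rewrite big_ord_recr /= -(increment_cov_catl p (a 0%N) (a j.+1) (b j.+1)) lerD2r.
  apply: (le_trans (ih (ltnW jk))).
  rewrite -(increment_cov_catl p (a 0%N) (b j) (a j.+1)) lerDl.
  apply: increment_cov_ge0 => //; [exact/ltW/blt/(ltn_trans jk)| |exact/ltW/alt].
  apply: (le_trans (ltW (alt (ltn_trans jk kn)))); exact: interlaced_le.
have k1 : (k.-1 < k)%N by rewrite prednK.
have := key _ k1; rewrite prednK// => /le_trans; apply.
rewrite -(increment_cov_catl p (a 0%N) (b k.-1) (a k)) lerDl.
by apply: increment_cov_ge0 => //; [exact: interlaced_le|exact/ltW/alt].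
Qed.

(** Induction on [k]: the bound is the variance of the increment from [a 0] to [b k]. By bilinearity
    at the point [a k.+1] it splits into two variances and twice a covariance, which dominate the
    three parts of the double sum. *)
Lemma interlaced_cov_sum k : (k < n)%N ->
  \sum_(i < k.+1) \sum_(j < k.+1) cov i j <= (b k - a 0%N) `^ p.
Proof.
elim: k => [|k ih] kn.
  by rewrite !big_ord1 /cov increment_cov_diag//; exact/ltW/alt.
rewrite big_ord_recr /= [X in _ + X]big_ord_recr /=.
under [X in X + _]eq_bigr do rewrite big_ord_recr /=.
rewrite big_split /=.
have L := interlaced_cov_last (ltn0Sn k) kn.
have -> : \sum_(i < k.+1) cov k.+1 i = \sum_(i < k.+1) cov i k.+1.
  by apply: eq_bigr => i _; rewrite /cov increment_covC.
have D : cov k.+1 k.+1 = (b k.+1 - a k.+1) `^ p.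
  by rewrite /cov increment_cov_diag//; exact/ltW/alt.
have I : \sum_(i < k.+1) \sum_(j < k.+1) cov i j <= (a k.+1 - a 0%N) `^ p.
  apply: (le_trans (ih (ltnW kn))); apply: ge0_ler_powR.
  - exact: le_trans p1.
  - rewrite nnegrE subr_ge0.
    case: k kn {L D ih} => [|k] kn; first exact/ltW/alt/ltnW.
    apply: (le_trans (ltW (alt (leq_ltn_trans (leq0n _) kn)))).
    apply: (le_trans (interlaced_le (ltn0Sn k) (ltnW kn))); exact/ltW/alt/ltnW.
  - by rewrite nnegrE subr_ge0 (le_trans (ltW (alt (leq_ltn_trans (leq0n _) kn))))// interlaced_le.
  - by rewrite lerD2r; exact/ltW/blt.
have a0k : a 0%N <= a k.+1.
  by rewrite (le_trans (ltW (alt (leq_ltn_trans (leq0n _) kn))))// interlaced_le.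
have abk : a k.+1 <= b k.+1 by exact/ltW/alt.
rewrite -(@increment_cov_diag _ p p1 _ _ (le_trans a0k abk)).
rewrite -(increment_cov_catl p (a 0%N) (a k.+1) (b k.+1)).
rewrite (increment_covC _ (a 0%N) (a k.+1)) (increment_covC _ (a k.+1) (b k.+1) (a 0%N)).
rewrite -(increment_cov_catl p (a 0%N) (a k.+1) (b k.+1) (a 0%N)).
rewrite -(increment_cov_catl p (a 0%N) (a k.+1) (b k.+1) (a k.+1)).
rewrite (increment_cov_diag p1 a0k) (increment_cov_diag p1 abk).
rewrite (increment_covC _ (a k.+1) (b k.+1) (a 0%N)).
rewrite D; lra.
Qed.

(** All covariances are nonnegative, so restricting to the indices selected by [e] can only lower
    the sum. *)
Lemma interlaced_cov_le (e : nat -> bool) : (0 < n)%N ->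
  \sum_(i < n | e i) \sum_(j < n | e j) cov i j <= (t - s) `^ p.
Proof.
move=> n0.
apply: (@le_trans _ _ (\sum_(i < n) \sum_(j < n) cov i j)).
  rewrite big_mkcond /=; apply: ler_sum => i _.
  have r0 : 0 <= \sum_(j < n) cov i j by apply: sumr_ge0 => j _; exact: cov_ge0.
  case: ifP => // _; rewrite big_mkcond; apply: ler_sum => j _.
  by case: ifP => // _; exact: cov_ge0.
have nn : (n.-1 < n)%N by rewrite prednK.
have := interlaced_cov_sum nn; rewrite prednK// => /le_trans; apply.
case: ab => sa _ _ bt.
have a0b : a 0%N <= b n.-1.
  have [->|m0] := posnP n.-1; first exact/ltW/alt.
  apply: (le_trans (ltW (alt n0))); apply: (le_trans (interlaced_le m0 nn)).
  exact/ltW/alt.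
apply: ge0_ler_powR; rewrite ?nnegrE ?subr_ge0//; first exact: le_trans p1.
  by rewrite (le_trans sa)// (le_trans a0b).
exact: lerB.
Qed.

End interlaced_covariance.

(** * Joint laws of finite linear combinations of the process *)

Section linear_functionals.
Context d (T : measurableType d) (R : realType) (P : probability T R).
Variables (H : R) (W : R -> {RV P >-> R}).
Hypothesis fbm : fractional_brownian_motion H W.
Implicit Types L M : seq (R * R).

(* A finite linear combination of values of [W] is a list of pairs (coefficient, time). *)
Definition functional L w : R := \sum_(x <- L) x.1 * W x.2 w.

Definition fbm_cov (s t : R) : R :=
  2^-1 * (`|s| `^ (2 * H) + `|t| `^ (2 * H) - `|t - s| `^ (2 * H)).

Definition functional_cov L M : R :=
  \sum_(x <- L) \sum_(y <- M) x.1 * y.1 * fbm_cov x.2 y.2.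

Definition nonneg_times L := all (fun x => 0 <= x.2) L.

Let mW t : measurable_fun setT (W t : T -> R).
Proof. exact: measurable_funP. Qed.

Lemma measurable_functional L : measurable_fun setT (functional L).
Proof. by apply: measurable_sum => x; exact: measurable_funM. Qed.

Lemma functional_gaussian_rv L : nonneg_times L -> gaussian_rv P (functional L).
Proof.
case: fbm => _ gW _ _ _ L0.
have := gW (size L) (fun i => (nth (0, 0) L i).2) (fun i => (nth (0, 0) L i).1).
rewrite (_ : (fun w => _) = functional L); first by apply => i; exact: (allP L0 _ (mem_nth _ _)).
by apply/funext => w; rewrite /functional (big_nth (0, 0)) big_mkord.
Qed.

(** Exponentials of [W t] and [- W t] dominate [W t] and, by [expR2_ge], the products [W s * W t];
    integrals of finite sums may then be split. *)
Let W_exp_integrable t l : 0 <= t -> P.-integrable setT (fun w => (expR (l * W t w))%:E).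
Proof.
move=> t0; have L0 : nonneg_times [:: (1, t)] by rewrite /nonneg_times /= t0.
have [m [s [_ _ mgf]]] := gaussian_mgf (measurable_functional _) (functional_gaussian_rv L0).
apply: (@ge0_integrable_fin _ _ _ P (fun w => expR (l * W t w)) (expR (l * m + l ^+ 2 * s ^+ 2 / 2))).
- by apply: measurableT_comp => //; exact: measurable_funM.
- by move=> w; exact: expR_ge0.
- apply: etrans (mgf l); apply: eq_integral => w _.
  by rewrite /functional big_seq1 mul1r.
Qed.

Let W_integrable t : 0 <= t -> P.-integrable setT (fun w => (W t w)%:E).
Proof.
move=> t0; have i1 := W_exp_integrable 1 t0; have i2 := W_exp_integrable (-1) t0.
apply: (le_integrable measurableT _ _ (integrableD measurableT i1 i2)).
  exact/measurable_EFinP.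
move=> w _ /=; rewrite lee_fin [leRHS]ger0_norm ?addr_ge0 ?expR_ge0//.
rewrite !mul1r mulN1r.
have h1 := expR_ge1Dx (W t w); have h2 := expR_ge1Dx (- W t w).
have h3 := expR_ge0 (W t w); have h4 := expR_ge0 (- W t w).
by rewrite ler_norml; apply/andP; split; lra.
Qed.

Let WW_integrable s t : 0 <= s -> 0 <= t -> P.-integrable setT (fun w => (W s w * W t w)%:E).
Proof.
move=> s0 t0.
have i1 := integrableD measurableT (W_exp_integrable 1 s0) (W_exp_integrable (-1) s0).
have i2 := integrableD measurableT (W_exp_integrable 1 t0) (W_exp_integrable (-1) t0).
apply: (le_integrable measurableT _ _ (integrableD measurableT i1 i2)).
  by apply/measurable_EFinP; exact: measurable_funM.
move=> w _ /=; rewrite lee_fin [leRHS]ger0_norm ?addr_ge0 ?expR_ge0//.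
have sq (z : R) : z ^+ 2 <= 2 * (expR (1 * z) + expR (-1 * z)).
  rewrite mul1r mulN1r; have h3 := expR_ge0 z; have h4 := expR_ge0 (- z).
  have [z0|/ltW z0] := leP 0 z; first by have := expR2_ge z0; lra.
  by have := @expR2_ge R (- z); rewrite oppr_ge0 sqrrN => /(_ z0); lra.
have := sq (W s w); have := sq (W t w).
have := sqr_ge0 (W s w - W t w); have := sqr_ge0 (W s w + W t w).
by rewrite ler_norml => h1 h2 h3 h4; apply/andP; split; nra.
Qed.

(* Nonnegative times are replaced by their absolute values to drop side conditions. *)
Let functional_norm L w : nonneg_times L ->
  functional L w = \sum_(x <- L) x.1 * W `|x.2| w.
Proof.
move=> L0; rewrite /functional; apply: eq_big_seq => x xL.
by rewrite ger0_norm//; exact: (allP L0 _ xL).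
Qed.

Let integral_functional L : nonneg_times L -> (\int[P]_w (functional L w)%:E = 0)%E.
Proof.
move=> L0; case: fbm => _ _ EW _ _.
have iW (x : R * R) : P.-integrable setT (fun w => (x.1 * W `|x.2| w)%:E).
  under eq_fun do rewrite EFinM.
  by apply: integrableZl => //; exact: W_integrable.
under eq_integral do rewrite functional_norm// -sumEFin.
rewrite integral_sum// big1// => x _.
under eq_integral do rewrite EFinM.
rewrite integralZl//; last exact: W_integrable.
by have := EW `|x.2| (normr_ge0 _); rewrite unlock => ->; rewrite mule0.
Qed.

Let integral_functional_sqr L : nonneg_times L ->
  (\int[P]_w (functional L w ^+ 2)%:E = (functional_cov L L)%:E)%E.
Proof.
move=> L0; case: fbm => _ _ _ EWW _.
have iWW (x y : R * R) : P.-integrable setT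
    (fun w => (x.1 * y.1 * (W `|x.2| w * W `|y.2| w))%:E).
  under eq_fun do rewrite EFinM.
  by apply: integrableZl => //; exact: WW_integrable.
transitivity (\int[P]_w (\sum_(x <- L) \sum_(y <- L) (x.1 * y.1 * (W `|x.2| w * W `|y.2| w))%:E))%E.
  apply: eq_integral => w _; rewrite functional_norm// expr2 mulr_suml -sumEFin.
  apply: eq_bigr => x _; rewrite mulr_sumr -sumEFin; apply: eq_bigr => y _.
  by congr EFin; ring.
rewrite integral_sum//; last by move=> x; exact: integrable_sum.
rewrite /functional_cov -sumEFin big_seq [RHS]big_seq; apply: eq_bigr => x xL.
rewrite integral_sum// -sumEFin big_seq [RHS]big_seq; apply: eq_bigr => y yL.
under eq_integral do rewrite EFinM.
rewrite integralZl//; last exact: WW_integrable.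
have x0 := allP L0 _ xL; have y0 := allP L0 _ yL.
have h := EWW _ _ x0 y0; rewrite unlock in h.
rewrite [RHS]EFinM; congr (_ * _)%E; apply: etrans h.
by apply: eq_integral => w _; rewrite !ger0_norm.
Qed.

Lemma functional_centered_gaussian L : nonneg_times L ->
  centered_gaussian P (functional_cov L L) (functional L).
Proof.
move=> L0; apply: gaussian_centered.
- exact: measurable_functional.
- exact: functional_gaussian_rv.
- exact: integral_functional.
- exact: integral_functional_sqr.
Qed.

(** A combination of functionals is again a functional: its list [M] concatenates the lists with
    rescaled coefficients, so the law of one functional suffices. *)
Lemma functional_jointly_gaussian (Ls : nat -> seq (R * R)) n (a : 'I_n -> R) :
  (forall k, nonneg_times (Ls k)) ->
  centered_gaussian P (\sum_i \sum_j a i * a j * functional_cov (Ls i) (Ls j))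
    (fun w => \sum_i a i * functional (Ls i) w).
Proof.
move=> L0.
pose scaled (i : 'I_n) := [seq (a i * x.1, x.2) | x <- Ls i].
pose M := flatten [seq scaled i | i <- enum 'I_n].
have M0 : nonneg_times M.
  apply/allP => x /flattenP[_ /mapP[i _ ->]] /mapP[y yi ->] /=.
  exact: (allP (L0 i) _ yi).
have sumM (f : R * R -> R) : \sum_(x <- M) f x = \sum_(i < n) \sum_(x <- Ls i) f (a i * x.1, x.2).
  by rewrite big_flatten big_map big_enum; apply: eq_bigr => i _; rewrite big_map.
have := functional_centered_gaussian M0.
have -> : functional_cov M M = \sum_i \sum_j a i * a j * functional_cov (Ls i) (Ls j).
  rewrite /functional_cov sumM; apply: eq_bigr => i _ /=.
  under eq_bigr do rewrite sumM.
  rewrite exchange_big /=; apply: eq_bigr => j _.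
  rewrite mulr_sumr; apply: eq_bigr => x _; rewrite mulr_sumr; apply: eq_bigr => y _.
  by ring.
have -> // : functional M = (fun w => \sum_i a i * functional (Ls i) w).
apply/funext => w; rewrite /functional sumM; apply: eq_bigr => i _.
by rewrite mulr_sumr; apply: eq_bigr => x _ /=; rewrite mulrA.
Qed.

End linear_functionals.

(** * Truncated variation of continuous paths *)

Section truncated_variation.
Context (R : realType).
Implicit Types (f : R -> R) (s t c : R).

Lemma DTV_opp c f s t : DTV c f s t = UTV c (fun x => - f x) s t.
Proof.
rewrite /DTV /UTV; congr ereal_sup; apply/seteqP; split=> x /=.
  move=> [n [a [b [n0 ab ->]]]]; exists n, a, b; split => //.
  by congr (_%:E); apply: eq_bigr => i _; rewrite opprK (addrC (f (a i))).
move=> [n [a [b [n0 ab ->]]]]; exists n, a, b; split => //.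
by congr (_%:E); apply: eq_bigr => i _; rewrite opprK (addrC (f (a i))).
Qed.

Lemma interlaced_mem s t n (a b : nat -> R) i : interlaced s t n a b -> (i < n)%N ->
  (s <= a i <= t) /\ (s <= b i <= t).
Proof.
move=> ab iN; have ai := interlaced_ge ab iN; have bi := interlaced_le_end ab iN.
have abi : a i <= b i by case: ab => _ h _ _; exact/ltW/h.
by rewrite ai bi (le_trans ai abi) (le_trans abi bi).
Qed.

Lemma eq_UTV c f g s t : (forall x, s <= x <= t -> f x = g x) -> UTV c f s t = UTV c g s t.
Proof.
move=> fg; rewrite /UTV; congr ereal_sup; apply/seteqP; split=> x /=.
  move=> [n [a [b [n0 ab ->]]]]; exists n, a, b; split => //.
  congr (_%:E); apply: eq_bigr => i _.
  by have [ai bi] := interlaced_mem ab (ltn_ord i); rewrite !fg.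
move=> [n [a [b [n0 ab ->]]]]; exists n, a, b; split => //.
congr (_%:E); apply: eq_bigr => i _.
by have [ai bi] := interlaced_mem ab (ltn_ord i); rewrite !fg.
Qed.

Lemma UTV_ge0 c f s t : s < t -> (0 <= UTV c f s t)%E.
Proof.
move=> st; pose y : \bar R := (\sum_(i < 1) Num.max (f t - f s - c) 0)%:E.
apply: (@le_trans _ _ y).
  by rewrite /y lee_fin; apply: sumr_ge0 => i _; rewrite le_max lexx orbT.
apply: ereal_sup_ubound; exists 1%N, (fun=> s), (fun=> t); split => //.
Qed.

Lemma UTV_ge_sum c f s t n (a b : nat -> R) (e : nat -> bool) :
  (0 < n)%N -> interlaced s t n a b ->
  ((\sum_(i < n | e i) (f (b i) - f (a i) - c))%:E <= UTV c f s t)%E.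
Proof.
move=> n0 ab; apply: (@le_trans _ _ (\sum_(i < n) Num.max (f (b i) - f (a i) - c) 0)%:E).
  rewrite lee_fin big_mkcond; apply: ler_sum => i _.
  by case: ifP => _; rewrite le_max lexx ?orbT.
by apply: ereal_sup_ubound; exists n, a, b.
Qed.

(** Paths are unconstrained at negative times; freezing them at their value at 0 gives continuity on
    the whole line without changing the variation on [[0, S]]. *)
Lemma continuous_within_max0 f : {within `[0, +oo[, continuous f} ->
  continuous (fun x : R => f (Num.max x 0)).
Proof.
have mem0 (y : R) : `[0, +oo[%classic (Num.max y 0).
  by rewrite /= in_itv/= andbT le_max lexx orbT.
move=> cf x; apply: (@cvg_comp _ _ _ (fun x : R => Num.max x 0) f _
  (within `[0, +oo[ (nbhs (Num.max x 0)))); last first.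
  by move/subspace_continuousP : cf; apply.
move=> A; rewrite /within/= => nA.
have cm : {for x, continuous (fun x : R => Num.max x 0)}.
  by apply: (@continuous_max R R id (fun=> 0)); [exact: cvg_id|exact: cvg_cst].
have nx : \forall y \near x, (fun z : R => `[0, +oo[%classic z -> A z) (Num.max y 0).
  exact: cm _ nA.
by apply: filterS nx => y /(_ (mem0 y)).
Qed.

Lemma continuous_scaled_max0 f k : {within `[0, +oo[, continuous f} ->
  continuous (fun x : R => k * f (Num.max x 0)).
Proof.
move=> cf x; apply: cvgM; first exact: cvg_cst.
by have := continuous_within_max0 cf => /(_ x); exact.
Qed.

(** A one-sided form of uniform continuity. If it failed, pairs of points at distance below
    [n.+1%:R^-1] would, along a subsequence, converge to a common point, where the increment of [f]
    tends to 0. *)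
Lemma continuous_uniform_increment f s t c : 0 < c -> continuous f ->
  exists2 d : R, 0 < d & forall x y, s <= x <= t -> s <= y <= t ->
    `|y - x| < d -> f y - f x < c.
Proof.
move=> c0 cf; apply: contrapT => /forall2NP nex.
have nx (n : nat) : exists z : R * R, [/\ s <= z.1 <= t, s <= z.2 <= t,
    `|z.2 - z.1| < n.+1%:R^-1 & c <= f z.2 - f z.1].
  have [/negP|] := nex n.+1%:R^-1; first by rewrite invr_gt0 ltr0n.
  move=> /existsNP[x /existsNP[y /not_implyP[hx /not_implyP[hy /not_implyP[hxy hf]]]]].
  by exists (x, y); split => //=; rewrite leNgt; exact/negP.
have /choice[z hz] := nx.
have bz : bounded_fun (fun n => (z n).1).
  exists (`|s| + `|t|); split; first exact: num_real.
  move=> M hM n _ /=; apply: (le_trans _ (ltW hM)).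
  have [/andP[h1 h2] _ _ _] := hz n.
  by rewrite ler_norml; have := ler_norm s; have := ler_norm t; have := ler_norm (- s);
    have := ler_norm (- t); rewrite !normrN => *; apply/andP; split; lra.
have [g ig /cvg_ex[x /= cx]] := bolzano_weierstrass bz.
have g_ge n : (n <= g n)%N.
  elim: n => // n ih; apply: (leq_ltn_trans ih).
  by have := ig n.+1 n; rewrite ltnn leEnat => /negbT; rewrite -ltnNge.
have cd : (fun n => (z (g n)).2 - (z (g n)).1) @ \oo --> (0 : R).
  apply/cvgrPdist_le => e e0; near=> n; rewrite sub0r normrN.
  have [_ _ h _] := hz (g n); apply: (le_trans (ltW h)).
  apply: (@le_trans _ _ (n.+1%:R^-1)).
    by rewrite lef_pV2 ?posrE ?ltr0n// ler_nat ltnS.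
  by apply: ltW; near: n; exact: (near_infty_natSinv_lt (PosNum e0)).
have cy : (fun n => (z (g n)).2) @ \oo --> x.
  have -> : (fun n => (z (g n)).2) = (fun n => ((z (g n)).2 - (z (g n)).1) + (z (g n)).1).
    by apply/funext => n; rewrite subrK.
  by rewrite -[x in _ --> x]add0r; apply: cvgD.
have cfd : (fun n => f (z (g n)).2 - f (z (g n)).1) @ \oo --> f x - f x.
  by apply: cvgB; [exact: (cvg_comp _ _ cy (cf x))|exact: (cvg_comp _ _ cx (cf x))].
rewrite subrr in cfd.
have : c <= 0.
  rewrite -(cvg_lim _ cfd)//; apply: limr_ge; first by apply/cvg_ex; exists 0.
  by near=> n; have [_ _ _] := hz (g n).
by rewrite leNgt c0.
Unshelve. all: by end_near. Qed.

Lemma interlaced_length s t n (a b : nat -> R) k : interlaced s t n a b -> (k < n)%N ->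
  \sum_(i < k.+1) (b i - a i) <= b k - a 0%N.
Proof.
move=> ab; elim: k => [|k ih] kn; first by rewrite big_ord1.
rewrite big_ord_recr/=.
have h1 := ih (ltnW kn).
have h2 : b k < a k.+1 by case: ab => _ _ h _; exact: h.
by apply: (le_trans (lerD h1 (lexx _))); lra.
Qed.

(** An interval shorter than [d] cannot rise by more than [c] and contributes 0; a longer one
    contributes at most the oscillation [D], hence at most [D / d] times its length, and the lengths
    add up to at most [t - s]. *)
Lemma UTV_lt_pinfty f s t c : 0 < c -> s <= t -> continuous f -> (UTV c f s t < +oo)%E.
Proof.
move=> c0 st cf; have [d d0 fd] := continuous_uniform_increment s t c0 cf.
have cfi : {within `[s, t], continuous f} by apply: continuous_subspaceT.
have [M _ fM] := EVT_max st cfi.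
have [m mi fm] := EVT_min st cfi.
pose D := f M - f m.
have D0 : 0 <= D by rewrite subr_ge0; exact: fM.
suff : (UTV c f s t <= (D / d * (t - s))%:E)%E by move=> /le_lt_trans; apply; exact: ltry.
apply: ub_ereal_sup => _ /= [n [a [b [n0 ab ->]]]]; rewrite lee_fin.
apply: (@le_trans _ _ (D / d * \sum_(i < n) (b i - a i))); last first.
  apply: ler_wpM2l; first by apply: divr_ge0 => //; exact: ltW.
  have nn : (n.-1 < n)%N by rewrite prednK.
  have := interlaced_length ab nn; rewrite prednK// => /le_trans; apply.
  by apply: lerB; case: ab.
rewrite mulr_sumr; apply: ler_sum => i _.
have [ai bi] := interlaced_mem ab (ltn_ord i).
have abi : a i < b i by case: ab => _ h _ _; exact: h.
have h0 : 0 <= D / d * (b i - a i).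
  by apply: mulr_ge0; [apply: divr_ge0 => //; exact: ltW|rewrite subr_ge0 ltW].
rewrite ge_max h0 andbT; have [dle|dlt] := leP d (b i - a i).
  apply: (@le_trans _ _ D).
    have := fM (b i); have := fm (a i); rewrite !in_itv/= /D => /(_ ai) h1 /(_ bi) h2.
    by move: (ltW c0) h1 h2 => /= *; lra.
  by rewrite mulrAC ler_pdivlMr//; apply: ler_wpM2l.
apply: le_trans h0; rewrite subr_le0; apply/ltW/fd => //.
by rewrite ger0_norm// subr_ge0 ltW.
Qed.

Definition grid (m p : nat) : R := p%:R / m.+1%:R.

Lemma grid_ge0 m p : 0 <= grid m p.
Proof. by rewrite divr_ge0. Qed.

(** Rounding down keeps the last time below the right endpoint of the interval. *)
Definition round (m : nat) (x : R) : nat := Num.truncn (x * m.+1%:R).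

Lemma grid_round_le m x : 0 <= x -> grid m (round m x) <= x.
Proof.
move=> x0; rewrite ler_pdivrMr ?ltr0n//.
by have /andP[] := truncn_itv (mulr_ge0 x0 (ler0n R m.+1)).
Qed.

Lemma cvg_grid_round x : 0 <= x -> (fun m => grid m (round m x)) @ \oo --> x.
Proof.
move=> x0; apply/cvgrPdist_le => e e0; near=> m.
have m0 : 0 < m.+1%:R :> R by rewrite ltr0n.
rewrite ger0_norm ?subr_ge0 ?grid_round_le//.
apply: (@le_trans _ _ (m.+1%:R^-1)).
  rewrite lerBlDl /grid -[X in _ + X]mul1r -mulrDl ler_pdivlMr// natr1.
  by have /andP[_ /ltW] := truncn_itv (mulr_ge0 x0 (ler0n R m.+1)).
by apply: ltW; near: m; exact: (near_infty_natSinv_lt (PosNum e0)).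
Unshelve. all: by end_near. Qed.

Lemma near_forall_ltn (Q : nat -> nat -> Prop) n :
  (forall i, (i < n)%N -> \forall m \near \oo, Q i m) ->
  \forall m \near \oo, forall i, (i < n)%N -> Q i m.
Proof.
elim: n => [|n ih] nQ; first exact: nearW.
have := ih (fun i h => nQ i (ltnW h)); have := nQ n (ltnSn n).
apply: filterS2 => m Qn Qm i; rewrite ltnS leq_eqVlt => /predU1P[->//|].
exact: Qm.
Qed.

(** Selecting the positive terms once and for all replaces the positive parts by an affine
    functional of [f]. The finitely many strict inequalities between times survive rounding to a
    fine grid, and continuity passes the bound to the limit. *)
Lemma UTV_le_grid f t c (x : \bar R) : continuous f ->
  (forall m n (a b : nat -> nat) (e : nat -> bool), (0 < n)%N ->
     interlaced 0 t n (grid m \o a) (grid m \o b) ->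
     ((\sum_(i < n | e i) (f (grid m (b i)) - f (grid m (a i)) - c))%:E <= x)%E) ->
  (UTV c f 0 t <= x)%E.
Proof.
move=> cf le_x; apply: ub_ereal_sup => _ /= [n [a [b [n0 ab ->]]]].
pose e i := 0 < f (b i) - f (a i) - c.
have -> : \sum_(i < n) Num.max (f (b i) - f (a i) - c) 0 =
    \sum_(i < n | e i) (f (b i) - f (a i) - c).
  by rewrite [RHS]big_mkcond; apply: eq_bigr => i _; rewrite /e maxEle; case: leP.
have a0 i : (i < n)%N -> 0 <= a i by move=> /(interlaced_mem ab)[/andP[]].
have b0 i : (i < n)%N -> 0 <= b i by move=> /(interlaced_mem ab)[_ /andP[]].
pose u m i := round m (a i); pose v m i := round m (b i).
have cvga i : (i < n)%N -> grid m (u m i) @[m --> \oo] --> a i.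
  by move=> iN; apply: cvg_grid_round; exact: a0.
have cvgb i : (i < n)%N -> grid m (v m i) @[m --> \oo] --> b i.
  by move=> iN; apply: cvg_grid_round; exact: b0.
have near_lt (y z : nat -> R) (l l' : R) : y @ \oo --> l -> z @ \oo --> l' -> l < l' ->
    \forall m \near \oo, y m < z m.
  move=> yl zl ll'; near=> m; apply: (@lt_trans _ _ ((l + l') / 2)).
    by near: m; apply: (cvgr_lt _ yl); rewrite midf_lt.
  by near: m; apply: (cvgr_gt _ zl); rewrite midf_lt.
have [sa alb bla bt] := ab.
pose y m : R := \sum_(i < n | e i) (f (grid m (v m i)) - f (grid m (u m i)) - c).
have cvgy : y @ \oo --> \sum_(i < n | e i) (f (b i) - f (a i) - c).
  apply: cvg_big => [|i _]; first by apply: add_continuous.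
  apply: cvgB; last exact: cvg_cst.
  by apply: cvgB; [exact: (cvg_comp _ _ (cvgb _ (ltn_ord i)) (cf _))|
    exact: (cvg_comp _ _ (cvga _ (ltn_ord i)) (cf _))].
suff ley : \forall m \near \oo, ((y m)%:E <= x)%E.
  apply: (cvge_to_le _ ley); apply: cvg_EFin => //; exact: nearW.
near=> m; apply: le_x => //; split.
- exact: grid_ge0.
- near: m; apply: near_forall_ltn => i iN.
  by apply: near_lt (cvga i iN) (cvgb i iN) _; exact: alb.
- suff: forall i, (i < n.-1)%N -> grid m (v m i) < grid m (u m i.+1).
    by move=> h i iN; apply: h; rewrite -ltnS prednK.
  near: m; apply: near_forall_ltn => i iN.
  have iN' : (i.+1 < n)%N by rewrite -ltnS prednK in iN *.
  by apply: near_lt (cvgb i (ltnW iN')) (cvga i.+1 iN') _; exact: bla.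
- apply: le_trans bt; apply: grid_round_le; apply: b0.
  by rewrite prednK.
Unshelve. all: by end_near. Qed.

End truncated_variation.

(* [(m, n, a, b, e)] encodes the functional [f |-> \sum_(i < n | e i) (f (b_i) - f (a_i) - c)],
   where [a] and [b] list the times as multiples of [1 / (m + 1)]. *)
Definition grid_code := (nat * nat * seq nat * seq nat * seq bool)%type.

(** * Countably many functionals with times on rational grids *)

Section grid_functionals.
Context (R : realType) (S c eps : R).
Implicit Types z : grid_code.

Definition valid_code z : bool := let: (m, n, a, b, e) := z in
  `[< (0 < n)%N /\ interlaced 0 S n (grid R m \o nth 0%N a) (grid R m \o nth 0%N b) >].

(** The sign [eps] is 1 for the upward and -1 for the downward variation, so one family serves
    both. *)
Definition code_increments z : seq (R * R) := let: (m, n, a, b, e) := z in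
  flatten [seq [:: (eps, grid R m (nth 0%N b i)); (- eps, grid R m (nth 0%N a i))] |
    i <- [seq i <- iota 0 n | nth false e i]].

Definition code_penalty z : R := let: (m, n, a, b, e) := z in
  \sum_(i < n | nth false e i) c.

(* Index 0 is reserved for the zero functional, as [gaussian_sup_deviation] requires. *)
Definition nth_code k : option grid_code :=
  if k is k'.+1 then obind (fun z => if valid_code z then Some z else None) (unpickle k')
  else None.

Definition nth_increments k := oapp code_increments [::] (nth_code k).
Definition nth_penalty k := oapp code_penalty 0 (nth_code k).

Lemma nth_code_valid k z : nth_code k = Some z -> valid_code z.
Proof. by case: k => //= k; case: unpickle => //= y; case: ifP => // yv [<-]. Qed.

Lemma nth_codeK z : valid_code z -> nth_code (pickle z).+1 = Some z.
Proof. by rewrite /= pickleK /= => ->. Qed.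

Lemma sum_code_increments m n a b e (F : R * R -> R) :
  \sum_(x <- code_increments (m, n, a, b, e)) F x = \sum_(i < n | nth false e i)
    (F (eps, grid R m (nth 0%N b i)) + F (- eps, grid R m (nth 0%N a i))).
Proof.
rewrite big_flatten big_map big_filter.
rewrite -(big_mkord (fun i => nth false e i) (fun i =>
  F (eps, grid R m (nth 0%N b i)) + F (- eps, grid R m (nth 0%N a i)))) /index_iota subn0.
by apply: eq_bigr => i _; rewrite big_cons big_seq1.
Qed.

Lemma nth_increments_nonneg k : nonneg_times (nth_increments k).
Proof.
rewrite /nth_increments; case: nth_code => // -[[[[m n] a] b] e].
apply/allP => x /flattenP[_ /mapP[i _ ->]].
by rewrite !inE => /orP[/eqP->|/eqP->] /=; exact: grid_ge0.
Qed.

(** The signs occur in pairs and disappear by [eps ^+ 2 = 1]; grouped by intervals, the covariance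
    is the double sum of [interlaced_cov_le] with [p = 2 * H]. Index 0, the empty list, has
    covariance 0. *)
Lemma nth_increments_cov_le (H : R) k : 2^-1 <= H -> 0 <= S -> eps ^+ 2 = 1 ->
  functional_cov H (nth_increments k) (nth_increments k) <= S `^ (2 * H).
Proof.
move=> H2 S0 eps2; rewrite /nth_increments.
case zk : nth_code => [[[[[m n] a] b] e]|]; last first.
  by rewrite /= /functional_cov big_nil powR_ge0.
have /asboolP[n0 ab] := nth_code_valid zk.
have H1 : 1 <= 2 * H by move: H2; lra.
have := interlaced_cov_le H1 ab (nth false e) n0; rewrite subr0; apply: le_trans.
rewrite [oapp _ _ _]/=; rewrite le_eqVlt; apply/orP; left; apply/eqP.
rewrite /functional_cov sum_code_increments; apply: eq_bigr => i _.
rewrite !sum_code_increments -big_split/=; apply: eq_bigr => j _.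
rewrite /fbm_cov /increment_cov.
have e2 x : eps * eps * x = x by rewrite -expr2 eps2 mul1r.
rewrite !mulrN !mulNr opprK !e2.
by rewrite (distrC (grid R m _) (grid R m (nth 0%N a i))); ring.
Qed.

End grid_functionals.

Section truncated_variation_deviation.
Context d (T : measurableType d) (R : realType) (P : probability T R).
Variables (H : R) (W : R -> {RV P >-> R}).
Implicit Types (S c eps u : R).

Lemma functional_code_increments eps m n a b e w :
  functional W (code_increments eps (m, n, a, b, e)) w = \sum_(i < n | nth false e i)
    (eps * W (grid R m (nth 0%N b i)) w - eps * W (grid R m (nth 0%N a i)) w).
Proof.
by rewrite /functional sum_code_increments; apply: eq_bigr => i _; rewrite mulNr.
Qed.

Lemma UTV_affine_sup S c eps w : 0 < S ->
  {within `[0, +oo[, continuous (fun t => W t w)} ->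
  UTV c (fun t => eps * W t w) 0 S =
  affine_sup (fun k => functional W (nth_increments S eps k)) (nth_penalty S c) w.
Proof.
move=> S0 cW; pose g (t : R) := eps * W (Num.max t 0) w.
have cg : continuous g.
  exact: continuous_scaled_max0 cW.
have gW t : 0 <= t -> eps * W t w = g t by move=> t0; rewrite /g max_l.
apply/eqP; rewrite eq_le; apply/andP; split; last first.
  apply: ub_ereal_sup => _ /= [k _ <-].
  rewrite /nth_increments /nth_penalty.
  case zk : nth_code => [[[[[m n] a] b] e]|]; last first.
    by rewrite /= /functional big_nil subrr; exact: UTV_ge0.
  have /asboolP[n0 ab] := nth_code_valid zk.
  rewrite [oapp _ _ _]/= [X in _ - X]/= functional_code_increments -sumrB.
  exact: (UTV_ge_sum c (fun t => eps * W t w) _ n0 ab).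
rewrite (eq_UTV c (g := g)); last by move=> x /andP[x0 _]; exact: gW.
apply: UTV_le_grid => // m n a b e n0 ab.
(* Only the first [n] values matter, so the functions can be replaced by finite lists, which form a
   countable type. *)
pose z : grid_code := (m, n, mkseq a n, mkseq b n, mkseq e n).
have nthE (X : Type) (x0 : X) h (i : 'I_n) : nth x0 (mkseq h n) i = h i by rewrite nth_mkseq.
have zv : valid_code S z.
  apply/asboolP; split => //; case: ab => sa alb bla bt; split => /=.
  - by rewrite nth_mkseq.
  - by move=> i iN; rewrite !nth_mkseq//; exact: alb.
  - by move=> i iN; rewrite !nth_mkseq//; [exact: bla|exact: ltnW].
  - by rewrite nth_mkseq// prednK.
apply: ereal_sup_ubound; exists (pickle z).+1 => //.
have zk : nth_code S (pickle z).+1 = Some z by exact: nth_codeK.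
rewrite /nth_increments /nth_penalty zk [oapp _ _ _]/= [X in _ - X]/=.
rewrite functional_code_increments -sumrB; congr (_%:E).
apply: eq_big => [i|i _]; first by rewrite nthE.
by rewrite !nthE !gW ?grid_ge0.
Qed.

Lemma truncated_variation_deviation S c eps u : fractional_brownian_motion H W ->
  2^-1 <= H -> 0 < S -> 0 < c -> eps ^+ 2 = 1 -> 0 < u ->
  (deviation_prob P (fun w => UTV c (fun t => (eps * W t w)%R) 0 S) u
   <= (2 * expR (- (2 / pi ^+ 2 * u ^+ 2 / S `^ (2 * H))))%:E)%E.
Proof.
move=> fbm H2 S0 c0 eps2 u0.
apply: (@gaussian_sup_deviation _ _ _ _
  (fun k => functional W (nth_increments S eps k)) (nth_penalty S c)
  (fun i j => functional_cov H (nth_increments S eps i) (nth_increments S eps j))) => //.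
- by move=> k; exact: measurable_functional.
- move=> n a; apply: (functional_jointly_gaussian fbm); exact: nth_increments_nonneg.
- by move=> k; apply: nth_increments_cov_le => //; exact: ltW.
- exact: powR_gt0.
- by move=> w; rewrite /functional big_nil.
- by move=> w; exact: UTV_ge0.
- have [_ _ _ _ cW] := fbm; apply: filterS cW => w cW.
  split; first exact: UTV_affine_sup.
  rewrite (@eq_UTV _ _ _ (fun t => eps * W (Num.max t 0) w)).
    apply: UTV_lt_pinfty => //; first exact: ltW.
    exact: continuous_scaled_max0 cW.
  by move=> x /andP[x0 _]; rewrite max_l.
Qed.

End truncated_variation_deviation.

(** * The two forms of the estimate *)

Lemma rescaled_exponent (R : realType) (S c H v : R) : 0 < S -> 0 < c -> 0 < H ->
  (S * c `^ (1 - 1 / H) * v) ^+ 2 / S `^ (2 * H) =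
  (S * c `^ (- (1 / H))) `^ (2 - 2 * H) * v ^+ 2.
Proof.
move=> S0 c0 H0; rewrite powRM ?powR_ge0 ?ltW// -powRrM.
rewrite [S `^ (_ - _)]powRD ?(gt_eqF S0) ?implybT//.
rewrite !exprMn powRN powR_mulrn ?ltW//.
have -> : (c `^ (1 - 1 / H)) ^+ 2 = c `^ (- (1 / H) * (2 - 2 * H)).
  rewrite -powR_mulrn ?powR_ge0// -powRrM; congr (_ `^ _).
  by field; rewrite gt_eqF.
by ring.
Qed.

Unset Implicit Arguments.

Theorem theorem2p4 (R : realType) :
  exists A B : R,
    [/\ 0 < A, A <= 2, 0 < B, 2 / pi ^+ 2 <= B &
      forall (d : measure_display) (T : measurableType d) (P : probability T R)
             (H : R) (W : R -> {RV P >-> R}) (S c : R),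
        fractional_brownian_motion H W ->
        2^-1 <= H -> H < 1 -> 0 < S -> 0 < c -> c <= S `^ H ->
        [/\ forall u : R, 0 < u ->
              (deviation_prob P (fun w => UTV c (fun t => W t w) 0 S) u
               <= (A * expR (- (B * S `^ (- (2 * H)) * u ^+ 2)))%:E)%E,
            forall v : R, 0 < v ->
              (deviation_prob P (fun w => UTV c (fun t => W t w) 0 S)
                 (S * c `^ (1 - 1 / H) * v)
               <= (A * expR (- (B * (S * c `^ (- (1 / H))) `^ (2 - 2 * H)
                                * v ^+ 2)))%:E)%E,
            forall u : R, 0 < u ->
              (deviation_prob P (fun w => DTV c (fun t => W t w) 0 S) u
               <= (A * expR (- (B * S `^ (- (2 * H)) * u ^+ 2)))%:E)%E &
            forall v : R, 0 < v ->
              (deviation_prob P (fun w => DTV c (fun t => W t w) 0 S)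
                 (S * c `^ (1 - 1 / H) * v)
               <= (A * expR (- (B * (S * c `^ (- (1 / H))) `^ (2 - 2 * H)
                                * v ^+ 2)))%:E)%E]].
Proof.
have pi0 : 0 < pi :> R by exact: pi_gt0.
(* The constants of the bound for finite maxima, unchanged by the passage to suprema: 2 counts the
   tails, and [2 / pi ^+ 2] is the optimum of the exponential Markov bound. *)
exists 2, (2 / pi ^+ 2); split => //.
  by rewrite divr_gt0// exprn_gt0.
move=> d T P H W S c fbm H2 H1 S0 c0 _.
have H0 : 0 < H by apply: lt_le_trans H2; rewrite invr_gt0.
have utv u : 0 < u -> (deviation_prob P (fun w => UTV c (fun t => W t w) 0 S) u
    <= (2 * expR (- (2 / pi ^+ 2 * (u ^+ 2 / S `^ (2 * H)))))%:E)%E.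
  move=> u0; rewrite mulrA.
  have -> : (fun w => UTV c (fun t => W t w) 0 S) =
      (fun w => UTV c (fun t => (1 * W t w)%R) 0 S).
    by apply/funext => w; apply: eq_UTV => t _; rewrite mul1r.
  by apply: (truncated_variation_deviation fbm); rewrite ?expr1n.
have dtv u : 0 < u -> (deviation_prob P (fun w => DTV c (fun t => W t w) 0 S) u
    <= (2 * expR (- (2 / pi ^+ 2 * (u ^+ 2 / S `^ (2 * H)))))%:E)%E.
  move=> u0; rewrite mulrA.
  have -> : (fun w => DTV c (fun t => W t w) 0 S) =
      (fun w => UTV c (fun t => (-1 * W t w)%R) 0 S).
    by apply/funext => w; rewrite DTV_opp; apply: eq_UTV => t _; rewrite mulN1r.
  by apply: (truncated_variation_deviation fbm); rewrite ?sqrrN ?expr1n.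
have scaled u : 2 / pi ^+ 2 * S `^ (- (2 * H)) * u ^+ 2 =
    2 / pi ^+ 2 * (u ^+ 2 / S `^ (2 * H)) by rewrite powRN -mulrA (mulrC (_^-1)).
have rescaled v : 2 / pi ^+ 2 * (S * c `^ (- (1 / H))) `^ (2 - 2 * H) * v ^+ 2 =
    2 / pi ^+ 2 * ((S * c `^ (1 - 1 / H) * v) ^+ 2 / S `^ (2 * H)).
  by rewrite rescaled_exponent// -mulrA.
have pos v : 0 < v -> 0 < S * c `^ (1 - 1 / H) * v.
  by move=> v0; rewrite !mulr_gt0// powR_gt0.
split=> u u0; rewrite ?scaled ?rescaled.
- exact: utv.
- exact/utv/pos.
- exact: dtv.
- exact/dtv/pos.
Qed.
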